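(* Let $\delta\in(0,2)$ be arbitrary, let $\Pi_\alpha$ be the spike and slab prior with slab density $\gamma(x)=c_\gamma(1+|x|)^{-1-\delta}$, and let $\delta<q\le2$. Suppose $s\to\infty$, $s=o(n)$ and $\kappa_1\log^2n\le s$ for some constant $\kappa_1>0$. For a fixed constant $M>0$ and deterministic $\alpha=\alpha(n)\in(0,1)$ let $$\mathcal C_{q,\alpha}=\{\theta\in\mathbb R^n:\ d_q(\theta,\hat\theta_\alpha)\le M\,v_{q,\alpha}(X)\},\qquad v_{q,\alpha}(X)=\int d_q(\theta,\hat\theta_\alpha)\,d\Pi_\alpha(\theta\mid X).$$ (i) If $s\log^{\delta/2}(n/s)/n\ll\alpha\le\alpha_1$ for a sufficiently small constant $\alpha_1>0$, then $$\inf_{\theta_0\in\ell_0[s]}E_{\theta_0}\big[\mathrm{diam}_q(\mathcal C_{q,\alpha})\big]\gg s\log^{q/2}(n/s).$$ (ii) If $(s/n)^{c_1}\lesssim\alpha\lesssim(s/n)\log^{\delta/2}(n/s)$ for some $c_1\ge1$, then $$\sup_{\theta_0\in\ell_0[s]}E_{\theta_0}\big[\mathrm{diam}_q(\mathcal C_{q,\alpha})\big]\lesssim s\log^{q/2}(n/s).$$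
   Context: Model: one observes $X=(X_1,\dots,X_n)$ with $X_i=\theta_i+\varepsilon_i$, $\varepsilon_i$ i.i.d. $N(0,1)$; $P_\theta$, $E_\theta$ denote the law of $X$ and its expectation. $s=s_n$ is a sequence, $\ell_0[s]=\{\theta\in\mathbb R^n: |\{i:\theta_i\ne0\}|\le s\}$, $d_q(\theta,\theta')=\sum_{i=1}^n|\theta_i-\theta_i'|^q$, $\mathrm{diam}_q(\mathcal C)=\sup_{\theta,\theta'\in\mathcal C}d_q(\theta,\theta')$. $a_n\lesssim b_n$ means $a_n\le Cb_n$ for some constant $C>0$; $a_n\ll b_n$ (equivalently $b_n\gg a_n$) means $a_n=o(b_n)$ as $n\to\infty$. Prior and posterior: $\phi$ is the standard normal density; $c_\gamma$ is the normalising constant of $\gamma$; $g=\phi*\gamma$. $\Pi_\alpha=\otimes_{i=1}^n((1-\alpha)\delta_0+\alpha G)$, where $G$ has density $\gamma$. The posterior is $\Pi_\alpha[\cdot\mid X]=\otimes_{i=1}^n\big((1-a_\alpha(X_i))\delta_0+a_\alpha(X_i)\gamma_{X_i}(\cdot)\big)$, where $\gamma_x(u)=\phi(x-u)\gamma(u)/g(x)$ and $a_\alpha(x)=\alpha g(x)/\{(1-\alpha)\phi(x)+\alpha g(x)\}$. $\hat\theta_\alpha$ is the vector of coordinatewise medians of the posterior. *)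

(* Defs.v *)
From mathcomp Require Import all_boot all_order all_algebra.
From mathcomp Require Import all_classical all_reals all_analysis.

Set Implicit Arguments.
Unset Strict Implicit.
Unset Printing Implicit Defensive.

Import Order.TTheory GRing.Theory Num.Theory.
Import numFieldNormedType.Exports.

Local Open Scope classical_set_scope.
Local Open Scope ring_scope.

(* Points of R^n are n-tuples; [n.-tuple T] carries the product sigma-algebra.
   Probability laws are plain set functions here, as [normal_prob] is. *)
Fixpoint prod_law (d : measure_display) (T : measurableType d) (R : realType)
    (n : nat) : ('I_n -> set T -> \bar R) -> set (n.-tuple T) -> \bar R :=
  match n with
  | 0 => fun _ => \d_[tuple]
  | n'.+1 => fun m =>
      pushforward (m ord0 \x prod_law (fun i => m (lift ord0 i)))%E
        (fun p : T * n'.-tuple T => [tuple of p.1 :: p.2])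
  end.

Definition is_median (R : realType) (mu : set R -> \bar R)
    (m : R) : Prop :=
  ((2^-1)%:E <= mu [set x | (x <= m)%R])%E /\ ((2^-1)%:E <= mu [set x | (m <= x)%R])%E.

(* The choice made by [xget] is immaterial for the posteriors below: they have
   a positive density away from 0, so their median is unique. *)
Definition median (R : realType) (mu : set R -> \bar R) : R :=
  xget 0 [set m | is_median mu m].

Definition Xlaw (R : realType) (n : nat) (theta : n.-tuple R) :
    set (n.-tuple (measurableTypeR R)) -> \bar R :=
  prod_law (fun i => normal_prob (tnth theta i) 1).

Definition expect (R : realType) (n : nat) (theta : n.-tuple R)
    (f : n.-tuple R -> \bar R) : \bar R :=
  (\int[Xlaw theta]_X f X)%E.

Definition sparse (R : realType) (n : nat) (s : R) : set (n.-tuple R) :=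
  [set theta | #|[pred i : 'I_n | tnth theta i != 0]|%:R <= s].

Definition dq (R : realType) (q : R) (n : nat) (t u : n.-tuple R) : R :=
  \sum_(i < n) `|tnth t i - tnth u i| `^ q.

Definition diamq (R : realType) (q : R) (n : nat) (C : set (n.-tuple R)) :
    \bar R :=
  ereal_sup [set (dq q p.1 p.2)%:E | p in C `*` C].

Definition phi (R : realType) : R -> R := normal_pdf 0 1.

Definition slab_kernel (R : realType) (delta x : R) : R :=
  (1 + `|x|) `^ (- 1 - delta).

Definition slab_cst (R : realType) (delta : R) : R :=
  (\int[lebesgue_measure]_x slab_kernel delta x)^-1.

Definition slab (R : realType) (delta x : R) : R :=
  slab_cst delta * slab_kernel delta x.

Definition slab_conv (R : realType) (delta x : R) : R :=
  \int[lebesgue_measure]_u (phi (x - u) * slab delta u).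

Definition slab_post (R : realType) (delta x u : R) : R :=
  phi (x - u) * slab delta u / slab_conv delta x.

Definition post_weight (R : realType) (delta alpha x : R) : R :=
  alpha * slab_conv delta x /
  ((1 - alpha) * phi x + alpha * slab_conv delta x).

(* Posterior law of one coordinate given the observation x, for the prior
   (1 - alpha) \d_0 + alpha G where G has density [slab delta]. *)
Definition post_coord (R : realType) (delta alpha x : R) :
    set (measurableTypeR R) -> \bar R := fun A =>
  ((1 - post_weight delta alpha x)%:E * @dirac _ (measurableTypeR R) (0 : R)%R R A +
   (post_weight delta alpha x)%:E *
     \int[lebesgue_measure]_(u in A) (slab_post delta x u)%:E)%E.

Definition posterior (R : realType) (delta alpha : R) (n : nat)
    (X : n.-tuple R) : set (n.-tuple (measurableTypeR R)) -> \bar R :=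
  prod_law (fun i => post_coord delta alpha (tnth X i)).

Definition post_median (R : realType) (delta alpha : R) (n : nat)
    (X : n.-tuple R) : n.-tuple R :=
  [tuple median (post_coord delta alpha (tnth X i)) | i < n].

Definition vq (R : realType) (delta q alpha : R) (n : nat) (X : n.-tuple R) :
    \bar R :=
  (\int[posterior delta alpha X]_theta
     (dq q theta (post_median delta alpha X))%:E)%E.

Definition cred (R : realType) (delta q M alpha : R) (n : nat)
    (X : n.-tuple R) : set (n.-tuple R) :=
  [set theta | ((dq q theta (post_median delta alpha X))%:E <=
                M%:E * vq delta q alpha X)%E].

Definition Ediam (R : realType) (delta q M alpha : R) (n : nat)
    (theta0 : n.-tuple R) : \bar R :=
  expect theta0 (fun X => diamq q (cred delta q M alpha X)).

Definition rate (R : realType) (s : nat -> R) (q : R) (n : nat) : R :=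
  s n * ln (n%:R / s n) `^ (q / 2).

(* Extended-real counterparts of o(.) and O(.), so that finiteness of the
   expected diameters is part of the upper bound instead of being hidden in
   [fine]. *)
Definition elittleo (R : realType) (a b : nat -> \bar R) : Prop :=
  forall e : R, 0 < e -> \forall n \near \oo, (`|a n| <= e%:E * `|b n|)%E.

Definition ebigO (R : realType) (a b : nat -> \bar R) : Prop :=
  exists2 C : R, 0 < C & \forall n \near \oo, (`|a n| <= C%:E * `|b n|)%E.

Definition sparsity_regime (R : realType) (kappa1 : R) (s : nat -> R) : Prop :=
  [/\ s @ \oo --> +oo,
      s =o_\oo (fun n => n%:R : R^o)
    & \forall n \near \oo, kappa1 * ln (n%:R : R) ^+ 2 <= s n].

(* Main.v *)
(* The diameter of a d_q-ball of radius M v lies between M v and 8 M v, and v is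
   the sum over the coordinates of the posterior risk w(X_i) of the median, so
   only E w(X_i) matters.  Put L = ln (1 / alpha).
   - For every observation, w <= C (1 + L^(q/2)): the slab part of the posterior
     concentrates around x, and the spike is negligible beyond |x| ~ sqrt L.
   - At a null coordinate E w <= C alpha (1 + L^((q - delta)/2)), because w(x)
     phi(x) <= C alpha (1 + |x|)^(q - 1 - delta) for |x| up to order sqrt L and
     the Gaussian tail takes care of larger |x|; the exponent exceeds -1, so the
     integral is governed by |x| ~ sqrt L.
   - Conversely, for sqrt L / 2 <= x <= sqrt L the spike has mass above 1/2, so
     the median is 0 and w(x) phi(x) >= c alpha x^(q - 1 - delta); hence
     E w >= c alpha L^((q - delta)/2).
   Both claims then compare s L^(q/2) and n alpha L^((q - delta)/2) with
   s ln(n/s)^(q/2). *)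
From HB Require Import structures.
Require Import Defs.
From mathcomp Require Import all_boot all_order all_algebra.
From mathcomp Require Import all_classical all_reals all_analysis.
From mathcomp Require Import measurable_realfun.
From mathcomp Require Import ring lra.

Set Implicit Arguments.
Unset Strict Implicit.
Unset Printing Implicit Defensive.

Import Order.TTheory GRing.Theory Num.Theory.
Import numFieldNormedType.Exports.

Local Open Scope classical_set_scope.
Local Open Scope ring_scope.

(** * Densities and product laws *)

(** Neither the diameter nor the risk of the median is known to be measurable in the observation, so
    every expectation is compared with that of an explicit measurable function: a majorant for the
    upper bound, a minorant for the lower one. The median itself is almost never computed. For upper
    bounds, its risk is at most 12 times the risk around any centre; the centre 0 suits null
    coordinates, since the spike then costs nothing, and the centre x gives the uniform bound, since
    the slab part of the posterior sits there. The lower bound uses null coordinates only, in a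
    window where the spike forces the median to be 0. The threshold for alpha comes from splitting
    ln(n/s)^(q/2) into ln(n/s)^(delta/2), which is asked of n alpha / s, and ln(n/s)^((q -
    delta)/2), which the null risk supplies when L and ln(n/s) are comparable. The radius sqrt (8 L)
    goes with cutting the exponent x^2/2 of phi into eighths: one absorbs polynomial factors, one is
    worth alpha, one keeps the remainder integrable. *)

Section integral_monotone.
Context d (T : measurableType d) (R : realType).
Variable mu : {measure set T -> \bar R}.
Local Open Scope ereal_scope.

(* The integral of a nonnegative function is a supremum over simple functions,
   so monotonicity needs no measurability; the diameters below are not known
   to be measurable. *)
Lemma ge0_le_integralT (f g : T -> \bar R) :
  (forall x, 0 <= f x) -> (forall x, f x <= g x) ->
  \int[mu]_x f x <= \int[mu]_x g x.
Proof.
move=> f0 fg; have g0 x : 0 <= g x by exact: le_trans (fg x).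
rewrite !ge0_integralTE//; apply: le_ereal_sup => _ [h /= hf <-].
by exists h => //= x; exact: le_trans (fg x).
Qed.

End integral_monotone.

Section density.
Context d (T : measurableType d) (R : realType).
Variable mu : {measure set T -> \bar R}.
Local Open Scope ereal_scope.

Definition density (p : T -> R) : set T -> \bar R :=
  fun A => \int[mu]_(x in A) (p x)%:E.

Variable p : T -> R.
Hypotheses (p0 : forall x, (0 <= p x)%R) (mp : measurable_fun setT p).

Let density_set0 : density p set0 = 0.
Proof. exact: integral_set0. Qed.

Let density_ge0 A : 0 <= density p A.
Proof. by apply: integral_ge0 => x _; rewrite lee_fin. Qed.

Let density_sigma_additive : semi_sigma_additive (density p).
Proof.
move=> /= A mA tA mUA.
rewrite /density/= ge0_integral_bigcup//=; last first.
- by move=> x _; rewrite lee_fin.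
- by apply/measurable_EFinP; exact: measurable_funTS.
apply: is_cvg_ereal_nneg_natsum_cond => n _ _.
by apply: integral_ge0 => /= x ?; rewrite lee_fin.
Qed.

Definition density_measure : {measure set T -> \bar R} :=
  HB.pack (density p)
    (isMeasure.Build _ _ _ (density p) density_set0 density_ge0
       density_sigma_additive).

Import HBNNSimple.

(** Monotone convergence on both sides reduces the claim to simple functions, and additivity to one
    level set, where it is the definition of [density]. *)
Lemma ge0_integral_density (f : T -> \bar R) :
  measurable_fun setT f -> (forall x, 0 <= f x) ->
  \int[density p]_x f x = \int[mu]_x (f x * (p x)%:E).
Proof.
move=> mf f0; pose f_ := nnsfun_approx measurableT mf.
have mEp : measurable_fun setT (EFin \o p) by exact/measurable_EFinP.
have cvgf x : EFin (f_ n x) @[n --> \oo] --> f x by exact: cvg_nnsfun_approx.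
have ndf x m n : (m <= n)%N -> (f_ m x <= f_ n x)%R.
  by move=> mn; exact/lefP/nd_nnsfun_approx.
have [nu nuE] : exists nu : {measure set T -> \bar R},
    (nu : set T -> \bar R) = density p by exists density_measure.
rewrite -nuE.
transitivity (limn (fun n => \int[nu]_x (f_ n x)%:E)).
  rewrite -monotone_convergence//.
  - by apply: eq_integral => x _; apply/esym/cvg_lim.
  - by move=> n; exact/measurable_EFinP/measurable_funP.
  - by move=> n x _; rewrite lee_fin.
  - by move=> x _ m n mn; rewrite lee_fin ndf.
transitivity (limn (fun n => \int[mu]_x ((f_ n x)%:E * (p x)%:E))); last first.
  rewrite -monotone_convergence//.
  - apply: eq_integral => x _; apply/cvg_lim => //.
    by apply: cvgeZr.
  - move=> n; apply: emeasurable_funM => //.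
    by apply/measurable_EFinP; exact: measurable_funP.
  - by move=> n x _; rewrite mule_ge0// lee_fin.
  - by move=> x _ m n mn; rewrite lee_wpmul2r ?lee_fin// ndf.
congr (limn _); apply/funext => n.
rewrite integralT_nnsfun sintegralE/=.
transitivity (\int[mu]_x (\sum_(r \in range (f_ n))
    (r * \1_(f_ n @^-1` [set r]) x)%:E * (p x)%:E)); last first.
  apply: eq_integral => x _.
  rewrite [in RHS]fimfunE -fsumEFin// ge0_mule_fsuml//.
  by move=> r; rewrite nnfun_muleindic_ge0.
have mfr r : measurable (f_ n @^-1` [set r]).
  exact: measurable_funPTI.
rewrite ge0_integral_fsum//; last 2 first.
- move=> r; apply: emeasurable_funM => //.
  by apply/measurable_EFinP; exact: measurable_funM.
- by move=> r x _; rewrite mule_ge0 ?lee_fin// -lee_fin nnfun_muleindic_ge0.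
apply: eq_fsbigr => r /set_mem rf.
have r0 : (0 <= r)%R by case: rf => y _ <-.
transitivity (r%:E * \int[mu]_x ((p x)%:E * (\1_(f_ n @^-1` [set r]) x)%:E)).
  rewrite nuE /density integral_mkcond epatch_indic//.
rewrite -ge0_integralZl//; last 2 first.
- by apply: emeasurable_funM => //; apply/measurable_EFinP.
- by move=> x _; rewrite mule_ge0// lee_fin.
by apply: eq_integral => x _; rewrite EFinM -muleA (muleC (p x)%:E).
Qed.

End density.

Section prod_law_probability.
Context d (T : measurableType d) (R : realType).
Local Open Scope ereal_scope.

(** Tonelli splits off the first coordinate; each of the two summands depends on one factor only, so
    the other factor contributes its total mass 1. Sums of one-coordinate functions are all that is
    integrated later, both for the posterior and for the law of the data. *)
Lemma prod_law_integral_sum n (m : 'I_n -> probability T R) :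
  exists2 P : probability (n.-tuple T) R,
    (P : set (n.-tuple T) -> \bar R) = prod_law (fun i => m i : set T -> \bar R)
  & forall f : 'I_n -> T -> \bar R,
    (forall i, measurable_fun setT (f i)) -> (forall i x, 0 <= f i x) ->
    \int[P]_X (\sum_(i < n) f i (tnth X i)) = \sum_(i < n) \int[m i]_x f i x.
Proof.
elim: n m => [|n IHn] m.
  exists (\d_([tuple] : 0.-tuple T)) => // f mf f0.
  rewrite big_ord0; under eq_integral do rewrite big_ord0.
  by rewrite integral0.
have [P PE intP] := IHn (fun i => m (lift ord0 i)).
pose c (p : T * n.-tuple T) : n.+1.-tuple T := [tuple of p.1 :: p.2].
have mc : measurable_fun setT c by exact: measurable_cons.
have [mu muE] : exists mu : probability (T * n.-tuple T)%type R,
    (mu : set _ -> \bar R) = m ord0 \x P by exists (m ord0 \x P)%E.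
pose cm : {mfun (T * n.-tuple T)%type >-> n.+1.-tuple T} :=
  HB.pack c (isMeasurableFun.Build _ _ _ _ c mc).
have [Q QE] : exists Q : probability (n.+1.-tuple T) R,
    (Q : set _ -> \bar R) = pushforward mu c by exists (distribution mu cm).
exists Q => [|f mf f0]; first by rewrite QE muE PE.
have mfX i : measurable_fun setT (fun X : n.+1.-tuple T => f i (tnth X i)).
  by apply: measurableT_comp => //; exact: measurable_tnth.
have mfY i : measurable_fun setT
    (fun X : n.-tuple T => f (lift ord0 i) (tnth X i)).
  by apply: measurableT_comp => //; exact: measurable_tnth.
rewrite QE ge0_integral_pushforward//; last 2 first.
- by apply: emeasurable_sum.
- by move=> X _; exact: sume_ge0.
rewrite preimage_setT big_ord_recl.
pose g (p : T * n.-tuple T) := \sum_(i < n) f (lift ord0 i) (tnth p.2 i).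
have mg : measurable_fun setT g.
  apply: emeasurable_sum => i.
  exact: (measurableT_comp (mfY i) measurable_snd).
have g0 p : 0 <= g p by exact: sume_ge0.
have mf0 : measurable_fun setT (fun p : T * n.-tuple T => f ord0 p.1).
  exact: (measurableT_comp (mf ord0) measurable_fst).
have intmu h : \int[mu]_p h p = \int[m ord0 \x P]_p h p by rewrite muE.
transitivity (\int[mu]_p (f ord0 p.1 + g p)).
  apply: eq_integral => p _ /=.
  rewrite big_ord_recl tnth0; congr (_ + _).
  by apply: eq_bigr => i _; rewrite tnthS.
rewrite ge0_integralD// !intmu.
rewrite !fubini_tonelli1//=.
congr (_ + _).
  apply: eq_integral => x _.
  by rewrite /fubini_F/= integral_cst// [X in _ * X]probability_setT mule1.
transitivity (\int[m ord0]_x (cst (\sum_(i < n)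
    \int[m (lift ord0 i)]_y f (lift ord0 i) y) x)).
  apply: eq_integral => x _; rewrite /fubini_F/= -intP//.
by rewrite integral_cst// [X in _ * X]probability_setT mule1.
Qed.

End prod_law_probability.

(** * Integrals of powers and Gaussian convolutions *)

Section real_line_integrals.
Context (R : realType).
Implicit Types (x y z r s : R).
Local Notation mu := (@lebesgue_measure R).

Lemma onePnorm_gt0 x : 0 < 1 + `|x|.
Proof. by rewrite ltr_pwDl. Qed.

Lemma onePnorm_ge1 x : 1 <= 1 + `|x|.
Proof. by rewrite lerDl. Qed.

Hint Resolve onePnorm_gt0 onePnorm_ge1 : core.

Lemma continuous_onePnorm_powR r : continuous (fun x => (1 + `|x|) `^ r).
Proof.
move=> x.
have h : {for 1 + `|x|, continuous (fun y : R => y `^ r)}.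
  apply: differentiable_continuous; apply/derivable1_diffP => /=.
  by apply: derivable_powR; rewrite in_itv/= andbT.
apply: (continuous_comp (f := fun x : R => 1 + `|x|) _ h).
by apply: cvgD; [exact: cvg_cst|exact: norm_continuous].
Qed.

Lemma measurable_onePnorm_powR r :
  measurable_fun setT (fun x : R => (1 + `|x|) `^ r).
Proof.
apply: (measurableT_comp (measurable_powR r)).
by apply: measurable_funD => //; exact: measurableT_comp.
Qed.

Lemma is_derive_onePpowR s x : - 1 < x -> s != 0 ->
  is_derive x 1 (fun x => s^-1 * (1 + x) `^ s) ((1 + x) `^ (s - 1)).
Proof.
move=> x0 s0; have x1 : 0 < 1 + x by lra.
have D : is_derive (1 + x) 1 (fun y : R => y `^ s) _ :=
  @is_derive1_powR R s _ x1.
apply: is_derive_eq.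
  apply: is_deriveZ.
  apply: (is_derive1_comp D).
by rewrite /GRing.scale/= add0r mulr1 mulrA mulVf// mul1r.
Qed.

Lemma continuous_onePpowR s x : - 1 < x -> s != 0 ->
  {for x, continuous (fun x => s^-1 * (1 + x) `^ s)}.
Proof.
move=> x1 s0; apply: differentiable_continuous; apply/derivable1_diffP.
by apply: ex_derive; exact: is_derive_onePpowR.
Qed.

Lemma cvg_powRN_y s : 0 < s -> (1 + x) `^ (- s) @[x --> +oo] --> (0 : R).
Proof.
move=> s0; apply/cvgrPdist_lt => e e0; near=> x.
have x0 : 0 < 1 + x by rewrite ltr_pwDl//; near: x; exact: nbhs_pinfty_ge.
rewrite sub0r normrN ger0_norm ?powR_ge0// powRN invf_plt ?posrE ?powR_gt0//.
have h : e^-1 `^ s^-1 < 1 + x.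
  by apply: (@lt_trans _ _ x); [near: x; exact: nbhs_pinfty_gt|rewrite ltrDr].
have := gt0_ltr_powR s0 _ _ h; rewrite -powRrM mulVf ?gt_eqF// powRr1.
  by apply; rewrite nnegrE ?powR_ge0 ?ltW.
by rewrite invr_ge0 ltW.
Unshelve. all: by end_near. Qed.

(** By symmetry, twice the integral over the half-line, which has an explicit primitive. At
    [s = delta] it shows that [slab_cst delta] is [delta / 2], hence positive. *)
Lemma integral_onePnorm_powR s : 0 < s ->
  (\int[mu]_x ((1 + `|x|) `^ (- 1 - s))%:E = (2 / s)%:E)%E.
Proof.
move=> s0; have Ns0 : - s != 0 by rewrite oppr_eq0 gt_eqF.
have dF x (x1 : - 1 < x) := is_derive_onePpowR x1 Ns0.
rewrite ge0_symfun_integralT/=; last 3 first.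
- by move=> x; exact: powR_ge0.
- exact: continuous_onePnorm_powR.
- by move=> x /=; rewrite normrN.
rewrite -set_itvcy (ge0_continuous_FTC2y
  (F := fun x => (- s)^-1 * (1 + x) `^ (- s)) (l := 0)).
- by rewrite addr0 powR1 mulr1 sub0e -EFinN -EFinM invrN opprK.
- by move=> x _; exact: powR_ge0.
- by apply: continuous_subspaceT; exact: continuous_onePnorm_powR.
- rewrite -[X in _ --> X](mulr0 (- s)^-1); apply: cvgMr.
  exact: cvg_powRN_y.
- by move=> x x0; apply: ex_derive; apply: dF; lra.
- by apply: cvg_at_right_filter; apply: continuous_onePpowR => //; lra.
- move=> x; rewrite in_itv/= andbT => x0.
  have dFx : - 1 < x by lra.
  have := dF _ dFx => ?; rewrite derive1E derive_val ger0_norm ?ltW//.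
  by rewrite (addrC (-1)).
Qed.

Lemma integral_onePpowR_itv s z : 0 < s -> 0 <= z ->
  (\int[mu]_(x in `[0%R, z]) ((1 + `|x|) `^ (s - 1))%:E <=
   ((1 + z) `^ s / s)%:E)%E.
Proof.
(* The fundamental theorem of calculus is applied on a nondegenerate interval, so [z = 0] is set
   apart. *)
move=> s0; rewrite le_eqVlt => /predU1P[<-|z0].
  by rewrite set_itv1 integral_set1 lee_fin divr_ge0 ?powR_ge0 ?ltW.
have sn0 : s != 0 by rewrite gt_eqF.
have dF x (x1 : - 1 < x) := is_derive_onePpowR x1 sn0.
rewrite (continuous_FTC2 (F := fun x => s^-1 * (1 + x) `^ s))//.
- rewrite addr0 powR1 mulr1 -EFinB lee_fin mulrC gerBl.
  by rewrite invr_ge0 ltW.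
- by apply: continuous_subspaceT; exact: continuous_onePnorm_powR.
- split.
  + move=> x; rewrite in_itv/= => /andP[x0 _].
    by apply: ex_derive; apply: dF; lra.
  + by apply: cvg_at_right_filter; apply: continuous_onePpowR => //; lra.
  + by apply: cvg_at_left_filter; apply: continuous_onePpowR => //; lra.
- move=> x; rewrite in_itv/= => /andP[x0 _].
  have dFx : - 1 < x by lra.
  by have := dF _ dFx => ?; rewrite derive1E derive_val ger0_norm ?ltW.
Qed.

Lemma integral_onePnorm_powR_itv s z : 0 < s -> 0 <= z ->
  (\int[mu]_(x in `[(- z)%R, z]) ((1 + `|x|) `^ (s - 1))%:E <=
   (2 * ((1 + z) `^ s / s))%:E)%E.
Proof.
move=> s0 z0.
pose f (x : R) := ((1 + `|x|) `^ (s - 1))%:E.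
have f0 x : (0 <= f x)%E by rewrite lee_fin powR_ge0.
have mf : measurable_fun setT f.
  by apply/measurable_EFinP; exact: measurable_onePnorm_powR.
rewrite (@itv_bndbnd_setU _ _ _ (BLeft 0)); last 2 first.
- by rewrite bnd_simp; lra.
- by rewrite bnd_simp.
rewrite ge0_integral_setU//; last 2 first.
- exact: measurable_funTS.
- apply/disj_setPRL => x /=; rewrite !in_itv/= => /andP[x0 _].
  by apply/negP; rewrite negb_and -!leNgt x0 orbT.
rewrite integral_itv_bndo_bndc; last exact: measurable_funTS.
rewrite -[X in `[- z, X]]oppr0 integration_by_substitution_oppr//.
  rewrite mulr_natl mulr2n EFinD; apply: leeD.
    by under eq_integral do rewrite /= normrN; exact: integral_onePpowR_itv.
  exact: integral_onePpowR_itv.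
by apply: continuous_subspaceT; exact: continuous_onePnorm_powR.
Qed.

End real_line_integrals.

Section gaussian_convolution.
Context (R : realType).
Implicit Types (x y z r s j : R).
Local Notation mu := (@lebesgue_measure R).

Lemma phiE x : phi x = normal_peak 1 * expR (- (x ^+ 2 / 2)) :> R.
Proof.
rewrite /phi normal_pdfE ?oner_neq0// /normal_fun subr0 expr1n mulNr.
by congr (_ * expR (- (_ / _))).
Qed.

Lemma phi_gt0 x : 0 < phi x.
Proof. by rewrite phiE mulr_gt0 ?expR_gt0 ?normal_peak_gt0. Qed.

Lemma measurable_phi_sub x : measurable_fun setT (fun u : R => phi (x - u)).
Proof.
apply: (measurableT_comp (measurable_normal_pdf 0 1)).
exact: measurable_funB.
Qed.

Lemma integral_normal_fun s x : 0 < s ->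
  (\int[mu]_u (normal_fun x s u)%:E = (normal_peak s)^-1%:E)%E.
Proof.
move=> s0; have sn0 : s != 0 by rewrite gt_eqF.
have k0 := normal_peak_gt0 sn0.
transitivity (\int[mu]_u ((normal_peak s)^-1%:E * (normal_pdf x s u)%:E))%E.
  apply: eq_integral => u _.
  by rewrite normal_pdfE// -EFinM mulrA mulVf ?mul1r ?gt_eqF.
rewrite ge0_integralZl_EFin//.
- by rewrite integral_normal_pdf mule1.
- by move=> u _; rewrite lee_fin normal_pdf_ge0.
- by apply/measurable_EFinP; exact: measurable_normal_pdf.
- by rewrite invr_ge0 ltW.
Qed.

(** With [t = |x|]: [1 + t <= exp t], and [t j <= 2 j^2 + t^2 / 8] because [(t - 4 j)^2 >= 0]. A
    polynomial factor thus costs only a quarter of the Gaussian exponent. *)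
Lemma onePnorm_powR_le_gauss j x : 0 <= j ->
  (1 + `|x|) `^ j <= expR (2 * j ^+ 2) * expR (x ^+ 2 / 8).
Proof.
move=> j0; have h : 1 + `|x| <= expR `|x| by exact: expR_ge1Dx.
apply: (@le_trans _ _ (expR (`|x| * j))).
  by rewrite expRM ge0_ler_powR ?nnegrE ?expR_ge0// addr_ge0.
rewrite -expRD ler_expR -(real_normK (num_real x)).
by have := sqr_ge0 (`|x| - 4 * j); nra.
Qed.

(** Peetre's inequality: [1 + |a| <= (1 + |b|) (1 + |a - b|)] raised to the power [|r|], with the
    roles of [x] and [y] exchanged when [r] is negative. It is the reason why smoothing by a
    Gaussian keeps polynomial orders. *)
Lemma onePnorm_powR_shift r x y :
  (1 + `|y|) `^ r <= (1 + `|x|) `^ r * (1 + `|y - x|) `^ `|r|.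
Proof.
have tri a b : 1 + `|a| <= (1 + `|b|) * (1 + `|a - b|) :> R.
  have : `|a| <= `|b| + `|a - b| by rewrite -{1}(subrKC b a) ler_normD.
  by have := normr_ge0 b; have := normr_ge0 (a - b); nra.
have [r0|r0] := leP 0 r.
  by rewrite (ger0_norm r0) -powRM ?ge0_ler_powR ?nnegrE ?mulr_ge0.
rewrite (ltr0_norm r0) -[X in _ `^ X <= _ `^ X * _](opprK r) !(powRN _ (- r)).
have x0 : 0 < (1 + `|x|) `^ (- r) by rewrite powR_gt0 ?onePnorm_gt0.
have y0 : 0 < (1 + `|y|) `^ (- r) by rewrite powR_gt0 ?onePnorm_gt0.
rewrite ler_pdivlMl// ler_pdivrMr// -powRM// ge0_ler_powR ?nnegrE ?mulr_ge0//.
  by rewrite oppr_ge0 ltW.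
by rewrite distrC mulrC.
Qed.

Lemma gauss_moment_le j : 0 <= j -> exists2 C : R, 0 < C & forall x,
  (\int[mu]_u ((1 + `|u - x|) `^ j * phi (x - u))%:E <= C%:E)%E.
Proof.
(* Variance 2: once the weight has taken [t^2 / 8] from the exponent [t^2 / 2], what is left is at
   least [t^2 / 4]. *)
move=> j0; pose s : R := Num.sqrt 2.
have s0 : 0 < s by rewrite sqrtr_gt0.
have sn0 : s != 0 by rewrite gt_eqF.
pose K : R := normal_peak 1 * expR (2 * j ^+ 2).
have K0 : 0 < K by rewrite mulr_gt0 ?expR_gt0 ?normal_peak_gt0.
exists (K * (normal_peak s)^-1) => [|x].
  by rewrite mulr_gt0// invr_gt0 normal_peak_gt0.
rewrite EFinM -(integral_normal_fun x s0) -ge0_integralZl_EFin//; last 3 first.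
- by move=> u _; rewrite lee_fin normal_fun_ge0.
- by apply/measurable_EFinP; exact: measurable_normal_fun.
- exact: ltW.
apply: ge0_le_integralT => u.
  by rewrite lee_fin mulr_ge0 ?powR_ge0// ltW// phi_gt0.
rewrite -EFinM lee_fin phiE /normal_fun sqr_sqrtr// /K.
rewrite mulrCA -[leRHS]mulrA ler_pM2l ?normal_peak_gt0//.
apply: (@le_trans _ _ (expR (2 * j ^+ 2) * expR ((u - x) ^+ 2 / 8) *
    expR (- ((x - u) ^+ 2 / 2)))).
  by rewrite ler_pM2r ?expR_gt0// onePnorm_powR_le_gauss.
rewrite -mulrA ler_pM2l ?expR_gt0// -expRD ler_expR -(mulr_natl 2) mulNr.
have : 0 <= (u - x) ^+ 2 by exact: sqr_ge0.
by rewrite -(sqrrN (x - u)) opprB; lra.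
Qed.

(** Peetre's inequality moves the weight from [u] to [x] at the price of [|r|] further powers of
    [1 + |u - x|], which a Gaussian moment bounds uniformly in [x]. *)
Lemma conv_powR_le r j : 0 <= j -> exists2 C : R, 0 < C & forall x,
  (\int[mu]_u ((1 + `|u|) `^ r * (1 + `|u - x|) `^ j * phi (x - u))%:E <=
   (C * (1 + `|x|) `^ r)%:E)%E.
Proof.
move=> j0.
have [C C0 hC] := @gauss_moment_le (`|r| + j) (addr_ge0 (normr_ge0 _) j0).
exists C => // x; rewrite mulrC EFinM.
apply: le_trans (lee_wpmul2l _ (hC x)); last by rewrite lee_fin powR_ge0.
rewrite -ge0_integralZl_EFin//; last 2 first.
- by move=> u _; rewrite lee_fin mulr_ge0 ?powR_ge0// ltW// phi_gt0.
- apply/measurable_EFinP/measurable_funM; last exact: measurable_phi_sub.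
  apply: (measurableT_comp (measurable_onePnorm_powR _)) => //.
  exact: measurable_funB.
apply: ge0_le_integralT => u.
  by rewrite lee_fin !mulr_ge0 ?powR_ge0// ltW// phi_gt0.
rewrite -EFinM lee_fin powRD; last first.
  by apply/implyP => _; rewrite (gt_eqF (onePnorm_gt0 _)).
rewrite !mulrA ler_pM2r ?phi_gt0// ler_pM2r ?powR_gt0 ?onePnorm_gt0//.
exact: onePnorm_powR_shift.
Qed.

(** Only an interval of length one is kept, where the Gaussian is at least [phi 1]. It lies to the
    right of [x] so that, for positive [x], an increasing power of [u] is at least its value at
    [x]. *)
Lemma conv_ge (h : R -> R) x b : (forall u, 0 <= h u) -> 0 <= b ->
  (forall u, x <= u <= x + 1 -> b <= h u) ->
  ((b * phi 1)%:E <= \int[mu]_u (h u * phi (x - u))%:E)%E.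
Proof.
move=> h0 b0 hb.
have -> : ((b * phi 1)%:E =
    \int[mu]_u ((b * phi 1) * \1_(`[x, x + 1]) u)%:E)%E.
  under eq_integral do rewrite EFinM.
  rewrite ge0_integralZl_EFin//; last 2 first.
  - by apply/measurable_EFinP; exact: measurable_indic.
  - by rewrite mulr_ge0// ltW// phi_gt0.
  rewrite integral_indic//= setIT lebesgue_measure_itv/= lte_fin ltrDl ltr01.
  by rewrite -EFinD addrAC subrr add0r mule1.
apply: ge0_le_integralT => u.
  by rewrite lee_fin !mulr_ge0// ltW// phi_gt0.
rewrite lee_fin indicE; case: (boolP (u \in _)) => /=; last first.
  by rewrite mulr0 mulr_ge0// ltW// phi_gt0.
rewrite inE/= in_itv/= mulr1 => xu; apply: ler_pM => //.
- by rewrite ltW// phi_gt0.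
- exact: hb.
- rewrite !phiE ler_pM2l ?normal_peak_gt0// ler_expR lerN2.
  by rewrite ler_pM2r// expr1n; case/andP: xu => *; nra.
Qed.

End gaussian_convolution.

(** * Medians *)

Section median_existence.
Context (R : realType).
Local Open Scope ereal_scope.

(** The identity is a random variable whose distribution is the given law, which brings in the
    properties of [cdf]. *)
Let idTR : measurableTypeR R -> R := idfun.

#[local] HB.instance Definition _ :=
  @isMeasurableFun.Build _ _ _ _ idTR (@measurable_id _ _ setT).

(** Existence of a median, so that [xget] does not fall back on its default 0. The witness is the
    lower 1/2-quantile, the infimum of the points where the distribution function reaches 1/2. *)
Lemma is_median_median (P : probability (measurableTypeR R) R) :
  is_median P (median P).
Proof.
apply: (@xgetPex _ 0%R [set m | is_median P m]).
pose X : {RV P >-> R} := idTR.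
have cdfE x : cdf X x = P [set y | (y <= x)%R].
  by rewrite /cdf /distribution /pushforward preimage_id set_itvNyc.
have half1 : (2^-1)%:E < 1 :> \bar R by rewrite lte_fin invf_lt1// ltr1n.
have half0 : 0 < (2^-1)%:E :> \bar R by rewrite lte_fin invr_gt0.
pose S := [set x : R | (2^-1)%:E <= cdf X x].
have [a Sa] : S !=set0.
  have near1 : \forall x \near +oo%R, (2^-1)%:E < cdf X x :=
    cvg_cdfy1 X (open_ereal_gt' half1).
  have [a aS] := filter_ex near1.
  by exists a; exact: ltW.
have near0 : \forall x \near -oo%R, cdf X x < (2^-1)%:E :=
  cvg_cdfNy0 X (open_ereal_lt' half0).
have [b bS] := filter_ex near0.
have Sb : lbound S b.
  move=> x Sx; rewrite leNgt; apply/negP => xb.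
  have := lt_le_trans bS (le_trans Sx (cdf_nondecreasing X (ltW xb))).
  by rewrite ltxx.
have infS : has_inf S := conj (ex_intro _ a Sa) (ex_intro _ b Sb).
have lt_inf x : (x < inf S)%R -> cdf X x < (2^-1)%:E.
  move=> xS; rewrite ltNge; apply/negP => Sx.
  by have := lt_le_trans xS (inf_lbound infS.2 Sx); rewrite ltxx.
exists (inf S); split.
  rewrite -cdfE leNgt; apply/negP => h.
  (* Were the distribution function below 1/2 at [inf S], it would stay so slightly to the right,
     beyond some point of [S]. *)
  have nearS : \forall x \near (inf S)^'+, cdf X x < (2^-1)%:E :=
    cdf_right_continuous (open_ereal_lt' h).
  have gtS : \forall x \near (inf S)^'+, (inf S < x)%R := nbhs_right_gt _.
  have [y [yS Sy]] :=
    @filter_ex _ _ (at_right_proper_filter _) _ (filterI nearS gtS).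
  have [x Sx xy] := inf_lt infS.1 Sy.
  have := lt_le_trans yS (le_trans Sx (cdf_nondecreasing X (ltW xy))).
  by rewrite ltxx.
rewrite leNgt; apply/negP => h.
(* The open half-line below [inf S] is the increasing union of these closed ones; each has mass
   below 1/2, so the union has mass at most 1/2. *)
pose F n : set (measurableTypeR R) := [set x | (x <= inf S - n.+1%:R^-1)%R].
have mF n : measurable (F n) by rewrite /F -set_itvNyc; exact: measurable_itv.
have UF : \bigcup_n F n = [set x | (x < inf S)%R].
  apply/seteqP; split => [x [n _ /=]|x /= xS].
    move=> h'; apply: le_lt_trans h' _.
    by rewrite ltrBlDr ltrDl invr_gt0.
  have [n hn] := ltr_add_invr xS; exists n => //=.
  by rewrite /F/= lerBrDr ltW.
have mlt : measurable [set x : measurableTypeR R | (x < inf S)%R].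
  by rewrite -UF; exact: bigcup_measurable.
have ndF : {homo F : n m / (n <= m)%N >-> (n <= m)%O}.
  move=> n m nm; apply/subsetPset => x /= /le_trans; apply.
  by rewrite lerD2l lerN2 lef_pV2 ?posrE// ler_nat.
have cvF : P (F n) @[n --> \oo] --> P (\bigcup_n F n).
  by apply: nondecreasing_cvg_mu => //; exact: bigcup_measurable.
have hP : (2^-1)%:E < P (\bigcup_n F n).
  move: h; rewrite UF; set A := [set x | _] in mlt *.
  have -> : [set x | (inf S <= x)%R] = ~` A.
    by apply/seteqP; split => x /=; rewrite leNgt => /negP.
  rewrite probability_setC// -(fineK (fin_num_measure P _ mlt)).
  by rewrite -EFinB !lte_fin; lra.
have nearP : \forall n \near \oo, (2^-1)%:E < P (F n) :=
  cvF _ (open_ereal_gt' hP).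
have [n] := filter_ex nearP.
have /lt_inf : (inf S - n.+1%:R^-1 < inf S)%R.
  by rewrite ltrBlDr ltrDl invr_gt0.
by rewrite cdfE => /lt_trans/[apply]; rewrite ltxx.
Qed.

End median_existence.

(** * The posterior of one coordinate *)

Section slab.
Context (R : realType) (delta : R).
Hypothesis delta0 : 0 < delta.
Implicit Types (x u r : R).
Local Notation mu := (@lebesgue_measure R).
Local Notation g := (slab_conv delta).

Lemma slab_cst_gt0 : 0 < slab_cst delta.
Proof.
by rewrite /slab_cst /Rintegral integral_onePnorm_powR//= invr_gt0 divr_gt0.
Qed.

Lemma slab_gt0 u : 0 < slab delta u.
Proof. by rewrite mulr_gt0 ?slab_cst_gt0 ?powR_gt0 ?onePnorm_gt0. Qed.

Lemma measurable_slab : measurable_fun setT (slab delta).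
Proof. by apply: measurable_funM => //; exact: measurable_onePnorm_powR. Qed.

Lemma measurable_phi_slab x :
  measurable_fun setT (fun u => phi (x - u) * slab delta u).
Proof.
by apply: measurable_funM; [exact: measurable_phi_sub|exact: measurable_slab].
Qed.

Lemma phi_slab_ge0 x u : 0 <= phi (x - u) * slab delta u.
Proof. by rewrite mulr_ge0// ltW ?phi_gt0 ?slab_gt0. Qed.

Let slab_conv_ereal_le : exists2 C : R, 0 < C & forall x,
  (\int[mu]_u (phi (x - u) * slab delta u)%:E <= C%:E)%E.
Proof.
have [C C0 hC] := @conv_powR_le R (-1 - delta) 0 (lexx _).
exists (slab_cst delta * C) => [|x]; first by rewrite mulr_gt0 ?slab_cst_gt0.
apply: (@le_trans _ _ ((slab_cst delta)%:E *
    (C * (1 + `|x|) `^ (-1 - delta))%:E)%E); last first.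
  rewrite -EFinM lee_fin ler_pM2l ?slab_cst_gt0// ler_piMr ?(ltW C0)//.
  rewrite -[leRHS](powRr0 (1 + `|x|)) ler_powR ?onePnorm_ge1//.
  by have := delta0; lra.
apply: le_trans (lee_wpmul2l _ (hC x)); last by rewrite lee_fin ltW ?slab_cst_gt0.
rewrite -ge0_integralZl_EFin//; last 3 first.
- by move=> u _; rewrite lee_fin !mulr_ge0 ?powR_ge0// ltW ?phi_gt0.
- apply/measurable_EFinP; under eq_fun do rewrite powRr0 mulr1.
  apply: measurable_funM; last exact: measurable_phi_sub.
  exact: measurable_onePnorm_powR.
- by rewrite ltW ?slab_cst_gt0.
apply: ge0_le_integralT => u; rewrite lee_fin ?phi_slab_ge0//.
by rewrite powRr0 mulr1 /slab /slab_kernel mulrC mulrA.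
Qed.

(** A real-valued integral is 0 by convention when the extended one is infinite; the uniform bound
    excludes this. *)
Lemma slab_convE x :
  ((g x)%:E = \int[mu]_u (phi (x - u) * slab delta u)%:E)%E.
Proof.
have [C C0 hC] := slab_conv_ereal_le.
rewrite /slab_conv /Rintegral fineK// ge0_fin_numE.
  by apply: le_lt_trans (hC x) _; rewrite ltry.
by apply: integral_ge0 => u _; rewrite lee_fin phi_slab_ge0.
Qed.

Lemma slab_conv_le : exists2 C : R, 0 < C & forall x, g x <= C.
Proof.
have [C C0 hC] := slab_conv_ereal_le.
by exists C => // x; rewrite -lee_fin slab_convE.
Qed.

(** The marginal inherits the heavy tail of the slab: for [u] in [[x, x + 1]] one has
    [1 + |u| <= 2 (1 + |x|)], hence the factor [2 ^ -(1 + delta)]. *)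
Lemma slab_conv_ge : exists2 c : R, 0 < c &
  forall x, c * (1 + `|x|) `^ (-1 - delta) <= g x.
Proof.
exists (slab_cst delta * 2 `^ (- (1 + delta)) * phi 1) => [|x].
  by rewrite !mulr_gt0 ?slab_cst_gt0 ?phi_gt0 ?powR_gt0.
rewrite -lee_fin slab_convE.
under eq_integral do rewrite mulrC.
rewrite mulrAC; apply: conv_ge.
- by move=> u; rewrite ltW ?slab_gt0.
- by rewrite !mulr_ge0 ?powR_ge0// ltW ?slab_cst_gt0.
move=> u xu; rewrite /slab /slab_kernel -mulrA ler_pM2l ?slab_cst_gt0//.
have e : -1 - delta = - (1 + delta) by lra.
rewrite e !(powRN _ (1 + delta)) -invfM lef_pV2 ?posrE; last 2 first.
- by rewrite mulr_gt0 ?powR_gt0 ?onePnorm_gt0.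
- by rewrite powR_gt0 ?onePnorm_gt0.
rewrite -powRM// ge0_ler_powR ?nnegrE ?mulr_ge0//.
  by have := delta0; lra.
have := ler_normD x (u - x); rewrite addrC subrK.
have : `|u - x| <= 1 by rewrite ler_norml; lra.
have := normr_ge0 x; lra.
Qed.

Lemma slab_conv_gt0 x : 0 < g x.
Proof.
have [c c0 hc] := slab_conv_ge.
by apply: lt_le_trans (hc x); rewrite mulr_gt0 ?powR_gt0 ?onePnorm_gt0.
Qed.

Lemma slab_post_ge0 x u : 0 <= slab_post delta x u.
Proof. by rewrite divr_ge0 ?phi_slab_ge0// ltW ?slab_conv_gt0. Qed.

Lemma measurable_slab_post x : measurable_fun setT (slab_post delta x).
Proof. by apply: measurable_funM => //; exact: measurable_phi_slab. Qed.

Lemma integral_slab_post x (h : R -> R) : measurable_fun setT h ->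
  (forall u, 0 <= h u) ->
  (\int[mu]_u (h u * slab_post delta x u)%:E =
   ((g x)^-1)%:E * \int[mu]_u (h u * slab delta u * phi (x - u))%:E)%E.
Proof.
move=> mh h0; rewrite -ge0_integralZl_EFin//; last 3 first.
- move=> u _; rewrite lee_fin mulr_ge0 ?(ltW (phi_gt0 _))//.
  by rewrite mulr_ge0 ?(ltW (slab_gt0 _)).
- apply/measurable_EFinP/measurable_funM; last exact: measurable_phi_sub.
  by apply: measurable_funM => //; exact: measurable_slab.
- by rewrite invr_ge0 ltW ?slab_conv_gt0.
apply: eq_integral => u _; rewrite -EFinM /slab_post; congr EFin; ring.
Qed.

End slab.

(** * Replacing the median by another centre *)

Section median_risk.
Context (R : realType) (q : R).
Hypotheses (q0 : 0 < q) (q2 : q <= 2).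
Implicit Types (a b y : R) (P : probability (measurableTypeR R) R).

(** [|a + b|] is at most twice the larger of the two absolute values, and [2^q <= 4]. The argument
    treats [q < 1] and [q >= 1] alike. *)
Lemma powR_normD_le a b : `|a + b| `^ q <= 4 * (`|a| `^ q + `|b| `^ q).
Proof.
have twoq : (2 : R) `^ q <= 4.
  apply: le_trans (ler_powR _ q2) _; first by rewrite ler1n.
  by rewrite powR_mulrn// -natrX.
have aux (c d : R) : `|c| <= `|d| -> `|c + d| `^ q <= 4 * (`|c| `^ q + `|d| `^ q).
  move=> cd; apply: (@le_trans _ _ ((2 * `|d|) `^ q)).
    rewrite ge0_ler_powR ?nnegrE ?mulr_ge0 ?(ltW q0)//.
    by have := ler_normD c d; lra.
  rewrite powRM//; have := powR_ge0 `|c| q; have := powR_ge0 `|d| q; nra.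
have [|/ltW ba] := leP `|a| `|b|; first exact: aux.
by have := aux _ _ ba; rewrite (addrC b) (addrC (`|b| `^ q)).
Qed.

Lemma measurable_norm_sub_powR y :
  measurable_fun setT (fun u : R => `|u - y| `^ q).
Proof.
apply: (measurableT_comp (measurable_powR q)).
by apply: measurableT_comp => //; exact: measurable_funB.
Qed.

Local Open Scope ereal_scope.

(** The half-line starting at the median and pointing away from [y] has mass at least 1/2, and its
    points are at least as far from [y] as the median is; Markov's inequality then costs a factor
    2. *)
Lemma median_dist_le P y (m := median P) :
  (`|m - y| `^ q)%:E <= 2%:E * \int[P]_u (`|u - y| `^ q)%:E.
Proof.
have half (A : set (measurableTypeR R)) : measurable A -> (2^-1)%:E <= P A ->
    (forall u, A u -> (`|m - y| <= `|u - y|)%R) ->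
    (`|m - y| `^ q)%:E <= 2%:E * \int[P]_u (`|u - y| `^ q)%:E.
  move=> mA PA hA; set c := (`|m - y| `^ q)%R.
  have c0 : (0 <= c)%R by exact: powR_ge0.
  have -> : c%:E = 2%:E * (c%:E * (2^-1)%:E).
    by rewrite -!EFinM; congr EFin; rewrite mulrCA divff ?mulr1.
  apply: lee_wpmul2l; first by rewrite lee_fin.
  apply: (@le_trans _ _ (c%:E * P A)); first by rewrite lee_wpmul2l ?lee_fin.
  have -> : P A = \int[P]_u (\1_A u)%:E by rewrite integral_indic// setIT.
  rewrite -ge0_integralZl_EFin//; last by apply/measurable_EFinP.
  apply: ge0_le_integralT => u; rewrite -EFinM lee_fin ?mulr_ge0// indicE.
  case: (boolP (u \in A)) => uA /=; last by rewrite mulr0 powR_ge0.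
  rewrite mulr1 ge0_ler_powR ?nnegrE ?(ltW q0)//.
  by apply: hA; exact: set_mem.
have [ml mr] := is_median_median P.
have [ym|/ltW my] := leP y m.
  apply: (half [set u | (m <= u)%R]) => //.
    by rewrite -set_itvcy; exact: measurable_itv.
  move=> u /= mu; rewrite ger0_norm ?subr_ge0// ger0_norm ?subr_ge0 ?lerD2r//.
  exact: le_trans mu.
apply: (half [set u | (u <= m)%R]) => //.
  by rewrite -set_itvNyc; exact: measurable_itv.
move=> u /= um; rewrite ler0_norm ?subr_le0// ler0_norm ?subr_le0.
  by rewrite lerN2 lerD2r.
exact: le_trans my.
Qed.

(** The constant is [12 = 4 (1 + 2)]: 4 from the quasi-triangle inequality through [y], 2 from
    [median_dist_le]. *)
Lemma median_risk_le P y :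
  \int[P]_u (`|u - median P| `^ q)%:E <=
  12%:E * \int[P]_u (`|u - y| `^ q)%:E.
Proof.
set m := median P; set I := \int[P]_u (`|u - y| `^ q)%:E.
have mE z : measurable_fun setT (fun u : measurableTypeR R =>
    (`|u - z| `^ q)%:E).
  by apply/measurable_EFinP; exact: measurable_norm_sub_powR.
have I0 : 0 <= I by apply: integral_ge0 => u _; rewrite lee_fin powR_ge0.
apply: (@le_trans _ _ (\int[P]_u (4%:E * ((`|u - y| `^ q)%:E +
    (`|m - y| `^ q)%:E)))).
  apply: ge0_le_integralT => u; first by rewrite lee_fin powR_ge0.
  rewrite -EFinD -EFinM lee_fin.
  have -> : (u - m = (u - y) + (y - m))%R by rewrite addrA subrK.
  by rewrite (distrC m y); exact: powR_normD_le.
rewrite ge0_integralZl_EFin//; last 2 first.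
- by move=> u _; rewrite adde_ge0// lee_fin powR_ge0.
- by apply: emeasurable_funD.
rewrite ge0_integralD//.
rewrite integral_cst// [X in _ + _ * X]probability_setT mule1 -/I.
have -> : 12%:E = 4%:E * 3%:E :> \bar R by rewrite -EFinM -natrM.
rewrite -muleA lee_wpmul2l ?lee_fin//.
have -> : 3%:E * I = I + 2%:E * I.
  by rewrite -[X in _ = X + _]mul1e -ge0_muleDl ?lee_fin// -EFinD -natr1 addrC.
by apply: leeD2l; exact: median_dist_le.
Qed.

End median_risk.

(** * Diameter of a ball for [dq] *)

Section credible_diameter.
Context (R : realType) (q : R).
Hypotheses (q0 : 0 < q) (q2 : q <= 2).

Lemma dq_le n (t u m : n.-tuple R) : dq q t u <= 4 * (dq q t m + dq q u m).
Proof.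
rewrite /dq -big_split mulr_sumr; apply: ler_sum => i _ /=.
rewrite (_ : tnth t i - tnth u i =
  (tnth t i - tnth m i) + (tnth m i - tnth u i)); last by rewrite addrA subrK.
by rewrite (distrC (tnth u i)); exact: powR_normD_le.
Qed.

Local Open Scope ereal_scope.

Lemma diamq_ball_le n (m : n.-tuple R) (V : \bar R) :
  diamq q [set t | (dq q t m)%:E <= V] <= 8%:E * V.
Proof.
apply: ge_ereal_sup => _ [[t u] [/= tV uV] <-].
apply: (@le_trans _ _ (4%:E * (V + V))); last first.
  rewrite -mule2n -mule_natl muleA -EFinM -natrM//.
apply: (@le_trans _ _ (4%:E * ((dq q t m)%:E + (dq q u m)%:E))).
  by rewrite -EFinD -EFinM lee_fin; exact: dq_le.
by rewrite lee_wpmul2l ?lee_fin// leeD.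
Qed.

(** Moving a single coordinate of the centre by [r^(1/q)] gives a point at distance exactly [r],
    which needs a dimension of at least one. All finite [r <= V] being reached, infinite [V] is
    covered too. *)
Lemma diamq_ball_ge n (m : n.+1.-tuple R) (V : \bar R) : 0 <= V ->
  V <= diamq q [set t | (dq q t m)%:E <= V].
Proof.
move=> V0; have sup_ge r : (0 <= r)%R -> r%:E <= V ->
    r%:E <= diamq q [set t | (dq q t m)%:E <= V].
  move=> r0 rV.
  pose t := [tuple (tnth m i + (if i == ord0 then r `^ q^-1 else 0))%R | i < n.+1].
  have tm : dq q t m = r.
    rewrite /dq big_ord_recl big1 => [|i _]; rewrite tnth_mktuple addrAC subrr add0r.
      rewrite addr0 ger0_norm ?powR_ge0// -powRrM mulVf ?gt_eqF//.
      by rewrite powRr1.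
    by rewrite normr0 powR0// gt_eqF.
  have mm : dq q m m = 0%R.
    by rewrite /dq big1// => i _; rewrite subrr normr0 powR0// gt_eqF.
  apply: ereal_sup_ubound; exists (t, m); last by rewrite /= tm.
  by split; rewrite /= ?tm ?mm.
case: V V0 sup_ge => [r r0 h|_ h|//]; first exact: h.
rewrite leye_eq; apply/eqP/eqyP => A A0.
exact: h (ltW A0) (leey _).
Qed.

End credible_diameter.

(** * Posterior law and posterior risk at one observation *)

Section posterior_coordinate.
Context (R : realType) (delta alpha : R).
Hypotheses (delta0 : 0 < delta) (alpha01 : 0 < alpha < 1).
Implicit Types (x y u : R).
Local Notation mu := (@lebesgue_measure R).
Local Notation g := (slab_conv delta).
Local Notation a := (post_weight delta alpha).
Local Notation D x := ((1 - alpha) * phi x + alpha * slab_conv delta x).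

Let alpha_gt0 : 0 < alpha. Proof. by case/andP: alpha01. Qed.
Let onem_alpha_gt0 : 0 < 1 - alpha.
Proof. by case/andP: alpha01 => _; rewrite subr_gt0. Qed.

Lemma marginal_gt0 x : 0 < (1 - alpha) * phi x + alpha * slab_conv delta x.
Proof. by rewrite addr_gt0 ?mulr_gt0 ?phi_gt0 ?slab_conv_gt0. Qed.

Lemma post_weight_ge0 x : 0 <= a x.
Proof.
by rewrite divr_ge0 ?mulr_ge0 ?(ltW (slab_conv_gt0 _ _)) ?(ltW (marginal_gt0 _))// ltW.
Qed.

Lemma onem_post_weight x : 1 - a x = (1 - alpha) * phi x / D x.
Proof.
have := lt0r_neq0 (marginal_gt0 x); rewrite /post_weight => h; field => //.
Qed.

Lemma onem_post_weight_ge0 x : 0 <= 1 - a x.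
Proof.
rewrite onem_post_weight divr_ge0 ?mulr_ge0 ?(ltW (phi_gt0 _))//; apply: ltW => //.
exact: marginal_gt0.
Qed.

Local Open Scope ereal_scope.

(** The posterior is built as a sum of two scaled measures, the Dirac mass at 0 and the measure with
    density [slab_post]; integrals then split by additivity. *)
Lemma post_coord_probability x :
  exists2 P : probability (measurableTypeR R) R,
    (P : set (measurableTypeR R) -> \bar R) = post_coord delta alpha x
  & forall h : R -> R, measurable_fun setT h -> (forall u, (0 <= h u)%R) ->
    \int[P]_u (h u)%:E = ((1 - a x) * h 0)%:E +
      (a x)%:E * \int[mu]_u (h u * slab_post delta x u)%:E.
Proof.
pose Q : {measure set (measurableTypeR R) -> \bar R} :=
  density_measure mu (slab_post_ge0 delta0 x) (measurable_slab_post delta x).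
pose P0 : {measure set (measurableTypeR R) -> \bar R} := measure_add
  (mscale (NngNum (onem_post_weight_ge0 x)) (@dirac _ (measurableTypeR R) 0%R R))
  (mscale (NngNum (post_weight_ge0 x)) Q).
have P0E : (P0 : set (measurableTypeR R) -> \bar R) = post_coord delta alpha x.
  by apply/funext => A; exact: measure_addE.
have intP (h : R -> R) : measurable_fun setT h -> (forall u, (0 <= h u)%R) ->
    \int[P0]_u (h u)%:E = ((1 - a x) * h 0)%:E +
      (a x)%:E * \int[mu]_u (h u * slab_post delta x u)%:E.
  move=> mh h0.
  have mEh : measurable_fun setT (fun u : measurableTypeR R => (h u)%:E).
    by apply/measurable_EFinP.
  have Eh0 (u : measurableTypeR R) : setT u -> 0 <= (h u)%:E.
    by move=> _; rewrite lee_fin.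
  rewrite (ge0_integral_measure_add _ _ measurableT Eh0 mEh).
  rewrite !(ge0_integral_mscale _ measurableT _ mEh Eh0).
  rewrite integral_dirac// diracT mul1e/= EFinM; congr (_ + _ * _).
  under [RHS]eq_integral do rewrite EFinM.
  have := @ge0_integral_density _ _ _ mu _ (slab_post_ge0 delta0 x)
    (measurable_slab_post delta x) _ mEh.
  by apply => u; rewrite lee_fin.
(* The total mass is the integral formula at the constant 1: it equals [(1 - a) + a], since [g] is
   the normalising constant of [slab_post]. *)
have P0T : P0 setT = 1.
  rewrite -[P0 setT]mul1e -integral_cst//.
  etransitivity.
    exact: (intP (fun=> 1%R) (measurable_cst _) (fun=> ler01)).
  rewrite mulr1 integral_slab_post//.
  have -> : \int[mu]_u (1 * slab delta u * phi (x - u))%:E = (g x)%:E.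
    rewrite slab_convE//; apply: eq_integral => u _.
    by rewrite mul1r mulrC.
  rewrite -EFinM mulVf; last by rewrite gt_eqF// slab_conv_gt0.
  by rewrite mulr1 -EFinD subrK.
pose P : probability (measurableTypeR R) R :=
  HB.pack (Measure.sort P0) (Measure_isProbability.Build _ _ _ P0 P0T).
by exists P.
Qed.

End posterior_coordinate.

Section posterior_risk.
Context (R : realType) (delta q : R).
Hypotheses (delta0 : 0 < delta) (delta_q : delta < q) (q2 : q <= 2).
Implicit Types (alpha x y u : R).
Local Notation mu := (@lebesgue_measure R).
Local Notation g := (slab_conv delta).
Local Notation D alpha x :=
  ((1 - alpha) * phi x + alpha * slab_conv delta x).
Local Notation L alpha := (ln alpha^-1).

Let q0 : 0 < q. Proof. exact: lt_trans delta_q. Qed.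

(* The contribution of a coordinate with observation x to vq. *)
Definition post_risk alpha x : \bar R :=
  (\int[post_coord delta alpha x]_u
     (`|u - median (post_coord delta alpha x)| `^ q)%:E)%E.

Lemma post_risk_ge0 alpha x : 0 < alpha < 1 -> (0 <= post_risk alpha x)%E.
Proof.
move=> a01; have [P PE _] := post_coord_probability delta0 a01 x.
rewrite /post_risk -PE.
by apply: integral_ge0 => u _; rewrite lee_fin powR_ge0.
Qed.

Lemma vqE alpha n (X : n.-tuple R) : 0 < alpha < 1 ->
  vq delta q alpha X = (\sum_(i < n) post_risk alpha (tnth X i))%E.
Proof.
move=> a01.
have /choice[P PE] x : exists P : probability (measurableTypeR R) R,
    (P : set (measurableTypeR R) -> \bar R) = post_coord delta alpha x.
  by have [P PE _] := post_coord_probability delta0 a01 x; exists P.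
pose f (i : 'I_n) (u : measurableTypeR R) :=
  (`|u - median (post_coord delta alpha (tnth X i))| `^ q)%:E.
have [Q QE intQ] := prod_law_integral_sum (fun i : 'I_n => P (tnth X i)).
have postE : posterior delta alpha X = Q.
  by rewrite QE /posterior; congr prod_law; apply/funext => i; rewrite PE.
rewrite /vq postE.
transitivity (\int[Q]_X (\sum_(i < n) f i (tnth X i)))%E.
  apply: eq_integral => t _; rewrite /dq -sumEFin; apply: eq_bigr => i _.
  by rewrite /post_median tnth_mktuple.
rewrite intQ.
- by apply: eq_bigr => i _; rewrite PE.
- by move=> i; apply/measurable_EFinP; exact: (measurable_norm_sub_powR q _).
- by move=> i x; rewrite lee_fin powR_ge0.
Qed.

(** Source of both upper bounds, with a free centre [y]. At [y = 0] the spike term vanishes; at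
    [y = x] it survives, but the slab moment [N] no longer carries the power [q] of [|x|]. *)
Lemma post_risk_le alpha x y N : 0 < alpha < 1 ->
  (\int[mu]_u (`|u - y| `^ q * slab delta u * phi (x - u))%:E <= N%:E)%E ->
  (post_risk alpha x <=
   (12 * (((1 - alpha) * phi x * `|y| `^ q + alpha * N) / D alpha x))%:E)%E.
Proof.
move=> a01 hN; have [P PE intP] := post_coord_probability delta0 a01 x.
rewrite /post_risk -PE; apply: le_trans (median_risk_le q0 q2 P y) _.
rewrite EFinM lee_wpmul2l ?lee_fin// intP; last 2 first.
- exact: (measurable_norm_sub_powR q _).
- by move=> u; rewrite powR_ge0.
rewrite integral_slab_post//; last exact: (measurable_norm_sub_powR q y).
have gx := slab_conv_gt0 delta0 x.
apply: (@le_trans _ _ (((1 - post_weight delta alpha x) * `|0 - y| `^ q)%:E +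
    (post_weight delta alpha x)%:E * (((g x)^-1)%:E * N%:E)))%E.
  apply: leeD => //; apply: lee_wpmul2l.
    by rewrite lee_fin; exact: post_weight_ge0.
  by apply: lee_wpmul2l => //; rewrite lee_fin invr_ge0 ltW.
rewrite -!EFinM -EFinD lee_fin sub0r normrN onem_post_weight// /post_weight.
have Dn0 := lt0r_neq0 (marginal_gt0 delta0 a01 x).
have gn0 := lt0r_neq0 gx.
rewrite le_eqVlt; apply/orP; left; apply/eqP.
by field; apply/andP.
Qed.

(** The function [h] is quantified after [x], as it may be centred at [x]; the constant [C] depends
    on neither. *)
Lemma slab_moment_le r j : 0 <= j -> exists2 C : R, 0 < C &
  forall x (h : R -> R), (forall u, 0 <= h u) ->
  (forall u, h u * slab_kernel delta u <= (1 + `|u|) `^ r * (1 + `|u - x|) `^ j) ->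
  (\int[mu]_u (h u * slab delta u * phi (x - u))%:E <=
   (C * (1 + `|x|) `^ r)%:E)%E.
Proof.
move=> j0; have [C C0 hC] := conv_powR_le r j0.
have cst0 := slab_cst_gt0 delta0.
exists (slab_cst delta * C) => [|x h h0 hh]; first by rewrite mulr_gt0.
rewrite -mulrA EFinM.
apply: le_trans (lee_wpmul2l _ (hC x)); last by rewrite lee_fin ltW.
rewrite -ge0_integralZl_EFin//; last 3 first.
- by move=> u _; rewrite lee_fin !mulr_ge0 ?powR_ge0// ltW ?phi_gt0.
- apply/measurable_EFinP; apply: measurable_funM; last exact: measurable_phi_sub.
  apply: measurable_funM; first exact: measurable_onePnorm_powR.
  apply: (measurableT_comp (measurable_onePnorm_powR j)).
  exact: measurable_funB.
- by rewrite ltW.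
apply: ge0_le_integralT => u; have p0 := phi_gt0 (x - u).
  by rewrite lee_fin mulr_ge0 ?(ltW p0)// mulr_ge0 ?h0// ltW// slab_gt0.
rewrite -EFinM lee_fin [leRHS]mulrA ler_pM2r// /slab mulrCA ler_pM2l//.
Qed.

Lemma slab_moment_origin_le : exists2 C : R, 0 < C & forall x,
  (\int[mu]_u (`|u - 0| `^ q * slab delta u * phi (x - u))%:E <=
   (C * (1 + `|x|) `^ (q - 1 - delta))%:E)%E.
Proof.
have [C C0 hC] := slab_moment_le (q - 1 - delta) (lexx 0).
exists C => // x; apply: hC => u; first by rewrite powR_ge0.
rewrite powRr0 mulr1 subr0 -addrA powRD; last first.
  by apply/implyP => _; rewrite (gt_eqF (onePnorm_gt0 _)).
rewrite ler_wpM2r ?powR_ge0// ge0_ler_powR ?nnegrE ?(ltW q0)//.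
by rewrite lerDr.
Qed.

(** The factor [|u - x|^q] goes entirely into the Gaussian moment. The power of [1 + |x|] left over
    is that of [slab_conv_ge], so dividing by [alpha g] gives a bounded quantity. *)
Lemma slab_moment_obs_le : exists2 C : R, 0 < C & forall x,
  (\int[mu]_u (`|u - x| `^ q * slab delta u * phi (x - u))%:E <=
   (C * (1 + `|x|) `^ (- 1 - delta))%:E)%E.
Proof.
have [C C0 hC] := slab_moment_le (- 1 - delta) (ltW q0).
exists C => // x; apply: hC => u; first by rewrite powR_ge0.
rewrite mulrC ler_wpM2l ?powR_ge0// ge0_ler_powR ?nnegrE ?(ltW q0)//.
by rewrite lerDr.
Qed.

Lemma lnV_ge0 alpha : 0 < alpha < 1 -> 0 <= L alpha.
Proof. by move=> /andP[a0 a1]; rewrite ln_ge0// invf_ge1// ltW. Qed.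

Lemma expR_tail alpha x : 0 < alpha < 1 -> Num.sqrt (8 * L alpha) < `|x| ->
  expR (- (x ^+ 2 / 8)) <= alpha.
Proof.
move=> a01 xL; have L0 := lnV_ge0 a01; have [a0 a1] := andP a01.
rewrite -[leRHS]lnK ?posrE// ler_expR.
have : 8 * L alpha <= x ^+ 2.
  rewrite -(real_normK (num_real x)) -[leLHS]sqr_sqrtr ?mulr_ge0//.
  by rewrite ler_pXn2r ?nnegrE ?sqrtr_ge0// ltW.
by rewrite lnV ?posrE//; lra.
Qed.

(** Of the four eighths in [x^2 / 2], one absorbs the polynomial, one becomes [alpha] by
    [expR_tail], and one remains on the right-hand side to be integrated. *)
Lemma powR_gauss_tail alpha x j : 0 < alpha < 1 -> 0 <= j ->
  Num.sqrt (8 * L alpha) < `|x| ->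
  (1 + `|x|) `^ j * phi x <=
    normal_peak 1 * expR (2 * j ^+ 2) * (alpha * expR (- (x ^+ 2 / 8))).
Proof.
move=> a01 j0 xz; have := expR_tail a01 xz; set e := expR _ => ea.
have e0 : 0 <= e by exact: expR_ge0.
rewrite phiE mulrCA -[leRHS]mulrA ler_pM2l ?normal_peak_gt0//.
apply: (@le_trans _ _ (expR (2 * j ^+ 2) * expR (x ^+ 2 / 8) *
    expR (- (x ^+ 2 / 2)))).
  by rewrite ler_pM2r ?expR_gt0// onePnorm_powR_le_gauss.
rewrite -mulrA ler_pM2l ?expR_gt0//.
apply: le_trans (ler_wpM2r e0 ea).
by rewrite -!expRD ler_expR; have := sqr_ge0 x; lra.
Qed.

End posterior_risk.

Section posterior_risk_bounds.
Context (R : realType) (delta q : R).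
Hypotheses (delta0 : 0 < delta) (delta_q : delta < q) (q2 : q <= 2).
Implicit Types (alpha x y u : R).
Local Notation mu := (@lebesgue_measure R).
Local Notation g := (slab_conv delta).
Local Notation D alpha x :=
  ((1 - alpha) * phi x + alpha * slab_conv delta x).
Local Notation L alpha := (ln alpha^-1).

Let q0 : 0 < q. Proof. exact: lt_trans delta_q. Qed.

Lemma sqrt_powR_le r y : 0 <= r <= 2 -> 0 <= y ->
  Num.sqrt (8 * y) `^ r <= 8 * y `^ (r / 2).
Proof.
move=> /andP[r0 r2] y0; rewrite -powR12_sqrt ?mulr_ge0// -powRrM (mulrC _ r).
rewrite powRM// ler_wpM2r ?powR_ge0//.
by rewrite -[leRHS]powRr1// ler_powR ?ler1n//; lra.
Qed.

Lemma post_risk_unif_le : exists2 C : R, 0 < C & forall alpha x,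
  0 < alpha < 1 ->
  (post_risk delta q alpha x <= (C * (1 + L alpha `^ (q / 2)))%:E)%E.
Proof.
have [c c0 hc] := slab_conv_ge delta0.
have [C C0 hC] := slab_moment_obs_le delta0 delta_q.
(* The power [q] is for [|x|^q], and [1 + delta] pays for dividing by the lower bound of [g]. *)
pose j := 1 + delta + q.
have j0 : 0 <= j by rewrite /j; have := delta0; have := q0; lra.
pose K := normal_peak 1 * expR (2 * j ^+ 2) : R.
have K0 : 0 < K by rewrite mulr_gt0 ?expR_gt0 ?normal_peak_gt0.
exists (12 * (8 + K / c + C / c)) => [|alpha x a01].
  by rewrite mulr_gt0// !addr_gt0 ?divr_gt0.
have [a0 a1] := andP a01; have L0 := lnV_ge0 a01.
apply: le_trans (post_risk_le delta0 delta_q q2 a01 (hC x)) _.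
rewrite lee_fin -[leRHS]mulrA ler_pM2l// mulrDl.
have D0 := marginal_gt0 delta0 a01 x; have gx := slab_conv_gt0 delta0 x.
have px := phi_gt0 x; set p := (1 + `|x|) `^ (- 1 - delta) in hc *.
have p0 : 0 < p by rewrite powR_gt0 ?onePnorm_gt0.
have Dge : alpha * (c * p) <= D alpha x.
  have : alpha * (c * p) <= alpha * g x.
    by rewrite ler_pM2l//; exact: hc.
  have : 0 <= (1 - alpha) * phi x by rewrite mulr_ge0 ?ltW ?subr_gt0.
  lra.
have Lq : 0 <= L alpha `^ (q / 2) by exact: powR_ge0.
have h1 : alpha * (C * p) / D alpha x <= C / c.
  rewrite ler_pdivrMr//.
  have -> : alpha * (C * p) = C / c * (alpha * (c * p)).
    by field; exact: lt0r_neq0.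
  by rewrite ler_pM2l ?divr_gt0.
have Cc : 0 < C / c by rewrite divr_gt0.
have Kc : 0 < K / c by rewrite divr_gt0.
(* Beyond sqrt (8 L) one has exp (- x^2 / 8) <= alpha, which absorbs the 1 / alpha
   lost in bounding the marginal density below by alpha g. *)
have [xz|zx] := leP `|x| (Num.sqrt (8 * L alpha)).
  have : (1 - alpha) * phi x * `|x| `^ q / D alpha x <= 8 * L alpha `^ (q / 2).
    apply: (@le_trans _ _ (`|x| `^ q)).
      rewrite ler_pdivrMr// mulrC ler_wpM2l ?powR_ge0//.
      by rewrite lerDl mulr_ge0// ltW.
    apply: le_trans (sqrt_powR_le _ L0); last by rewrite (ltW q0).
    by rewrite ge0_ler_powR ?nnegrE ?(ltW q0).
  by nra.
have : (1 - alpha) * phi x * `|x| `^ q / D alpha x <= K / c.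
  rewrite ler_pdivrMr//.
  apply: (@le_trans _ _ (K / c * (alpha * (c * p)))); last by rewrite ler_pM2l.
  have -> : K / c * (alpha * (c * p)) = K * alpha * p.
    by field; exact: lt0r_neq0.
  have := powR_gauss_tail a01 j0 zx; rewrite -/K; set e := expR _ => tail.
  have e1 : e <= 1.
    by rewrite -[leRHS]expR0 ler_expR oppr_le0 divr_ge0 ?sqr_ge0.
  apply: (@le_trans _ _ ((1 + `|x|) `^ j * phi x * p)); last first.
    rewrite ler_pM2r//; apply: le_trans tail _.
    by rewrite ler_pM2l// ger_pMr.
  have -> : (1 + `|x|) `^ j * phi x * p = phi x * (1 + `|x|) `^ q.
    rewrite mulrAC /p -powRD; last first.
      by apply/implyP => _; rewrite (gt_eqF (onePnorm_gt0 _)).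
    by rewrite mulrC; congr (_ * _ `^ _); rewrite /j; ring.
  have xq : `|x| `^ q <= (1 + `|x|) `^ q.
    by rewrite ge0_ler_powR ?nnegrE ?(ltW q0)// lerDr.
  apply: ler_pM => //; rewrite ?mulr_ge0 ?powR_ge0 ?(ltW px)//; first by lra.
  by rewrite ger_pMl//; lra.
by nra.
Qed.

(** The division by [phi x] will cancel against the null density. Inside the window the marginal is
    at least [(1 - alpha) phi x], hence [phi x / 2]; outside it is at least [alpha g x], and
    [powR_gauss_tail] gives back the factor [alpha] lost there. *)
Lemma post_risk_null_le : exists2 C : R, 0 < C & forall alpha x,
  0 < alpha <= 2^-1 ->
  (post_risk delta q alpha x <= (C * alpha *
    ((\1_`[(- Num.sqrt (8 * L alpha))%R, Num.sqrt (8 * L alpha)] x : R) *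
       (1 + `|x|) `^ (q - delta - 1) + expR (- (x ^+ 2 / 8))) / phi x)%:E)%E.
Proof.
have [c c0 hc] := slab_conv_ge delta0.
have [C C0 hC] := slab_moment_origin_le delta0 delta_q.
pose K := normal_peak 1 * expR (2 * q ^+ 2) : R.
have K0 : 0 < K by rewrite mulr_gt0 ?expR_gt0 ?normal_peak_gt0.
exists (12 * C * (2 + K / c)) => [|alpha x /andP[a0 a2]].
  by rewrite !mulr_gt0// addr_gt0 ?divr_gt0.
have a01 : 0 < alpha < 1 by rewrite a0/=; lra.
apply: le_trans (post_risk_le delta0 delta_q q2 a01 (hC x)) _.
rewrite normr0 powR0 ?(gt_eqF q0)// mulr0 add0r lee_fin.
have D0 := marginal_gt0 delta0 a01 x; have gx := slab_conv_gt0 delta0 x.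
have px := phi_gt0 x.
have -> : q - delta - 1 = q - 1 - delta by ring.
set p := (1 + `|x|) `^ (q - 1 - delta).
have p0 : 0 < p by rewrite powR_gt0 ?onePnorm_gt0.
set e := expR _; have e0 : 0 < e by exact: expR_gt0.
have Kc : 0 < K / c by rewrite divr_gt0.
set I := \1_ _ x; have Dn0 := lt0r_neq0 D0; have pn0 := lt0r_neq0 px.
have key : p / D alpha x <= (2 + K / c) * ((I * p + e) / phi x).
  have I0 : 0 <= I * p by rewrite mulr_ge0 ?(ltW p0).
  have [xz|zx] := leP `|x| (Num.sqrt (8 * L alpha)).
    have -> : I = 1 by rewrite /I indicE mem_set//= in_itv/= -ler_norml.
    have h : p / D alpha x <= 2 * (p / phi x).
      rewrite ler_pdivrMr//.
      have -> : 2 * (p / phi x) * D alpha x = p * (2 * D alpha x / phi x).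
        by field.
      rewrite ler_pMr// ler_pdivlMr// mul1r.
      by have := mulr_gt0 a0 gx; nra.
    have : 0 <= e / phi x by rewrite divr_ge0 ?ltW.
    have : 0 <= p / phi x by rewrite divr_ge0 ?ltW.
    by rewrite mul1r (mulrDl p); nra.
  have tail := powR_gauss_tail a01 (ltW q0) zx.
  have h : p / D alpha x <= K / c * (e / phi x).
    have Dge : alpha * (c * (1 + `|x|) `^ (- 1 - delta)) <= D alpha x.
      have : alpha * (c * (1 + `|x|) `^ (- 1 - delta)) <= alpha * g x.
        by rewrite ler_pM2l//; exact: hc.
      have : 0 <= (1 - alpha) * phi x by rewrite mulr_ge0 ?(ltW px)//; lra.
      lra.
    rewrite ler_pdivrMr//.
    have s0 : 0 < K / c * (e / phi x) by rewrite mulr_gt0 ?divr_gt0.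
    apply: (@le_trans _ _ (K / c * (e / phi x) *
        (alpha * (c * (1 + `|x|) `^ (- 1 - delta))))); last by rewrite ler_pM2l.
    have -> : K / c * (e / phi x) * (alpha * (c * (1 + `|x|) `^ (- 1 - delta)))
        = K * (alpha * e) * (1 + `|x|) `^ (- 1 - delta) / phi x.
      by field; rewrite pn0 lt0r_neq0.
    rewrite ler_pdivlMr//.
    have -> : p = (1 + `|x|) `^ q * (1 + `|x|) `^ (- 1 - delta).
      rewrite -powRD; last by apply/implyP => _; rewrite (gt_eqF (onePnorm_gt0 _)).
      by congr (_ `^ _); ring.
    by rewrite mulrAC ler_pM2r ?powR_gt0 ?onePnorm_gt0.
  have : 0 <= I * p / phi x by rewrite divr_ge0// ltW.
  have : 0 <= e / phi x by rewrite divr_ge0 ?ltW.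
  by rewrite (mulrDl (I * p)); nra.
have -> : 12 * (alpha * (C * p) / D alpha x) = 12 * C * alpha * (p / D alpha x).
  by field.
have -> : 12 * C * (2 + K / c) * alpha * (I * p + e) / phi x =
    12 * C * alpha * ((2 + K / c) * ((I * p + e) / phi x)).
  by field; rewrite pn0 lt0r_neq0.
by rewrite ler_pM2l// !mulr_gt0.
Qed.

End posterior_risk_bounds.

(** * Expected risk of a null coordinate *)

Section null_risk.
Context (R : realType) (delta q : R).
Hypotheses (delta0 : 0 < delta) (delta_q : delta < q) (q2 : q <= 2).
Implicit Types (alpha x y u : R).
Local Notation mu := (@lebesgue_measure R).
Local Notation g := (slab_conv delta).
Local Notation L alpha := (ln alpha^-1).

Let q0 : 0 < q. Proof. exact: lt_trans delta_q. Qed.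

Lemma measurable_phi : measurable_fun setT (@phi R).
Proof. exact: measurable_normal_pdf. Qed.

Lemma measurable_div_phi (f : R -> R) : measurable_fun setT f ->
  measurable_fun setT (fun x => f x / phi x).
Proof.
move=> mf; apply: measurable_funM => //.
have -> : (fun x : R => (phi x)^-1) =
    fun x => (normal_peak 1)^-1 * expR (x ^+ 2 / 2).
  by apply/funext => x; rewrite phiE invfM -expRN opprK.
apply: measurable_funM => //; apply: measurableT_comp => //.
by apply: measurable_funM => //; exact: measurable_funX.
Qed.

Lemma null_integral_div_phi (f : R -> R) : measurable_fun setT f ->
  (forall x, 0 <= f x) ->
  (\int[normal_prob (0 : R) 1]_x (f x / phi x)%:E = \int[mu]_x (f x)%:E)%E.
Proof.
move=> mf f0.
have mEf : measurable_fun setT (fun x : R => (f x / phi x)%:E).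
  by apply/measurable_EFinP; exact: measurable_div_phi.
(* The standard normal law is by conversion the set function with Lebesgue density [phi]. *)
rewrite -[LHS]/(\int[density mu (@phi R)]_x (f x / phi x)%:E)%E.
rewrite (ge0_integral_density mu (fun x => ltW (phi_gt0 x)) measurable_phi mEf).
  apply: eq_integral => x _; rewrite -EFinM divfK//.
  by rewrite gt_eqF ?phi_gt0.
by move=> x; rewrite lee_fin divr_ge0// ltW ?phi_gt0.
Qed.

(** The function [h] is the measurable majorant that stands for the risk under the integral sign.
    Its main part integrates to the order [z^(q - delta)] over the window [[-z, z]]. *)
Lemma null_risk_le : exists2 C : R, 0 < C & forall alpha, 0 < alpha <= 2^-1 ->
  exists h : R -> R, [/\ measurable_fun setT h, forall x, 0 <= h x,
    forall x, (post_risk delta q alpha x <= (h x)%:E)%E &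
    (\int[normal_prob (0 : R) 1]_x (h x)%:E <=
     (C * (alpha * (1 + L alpha `^ ((q - delta) / 2))))%:E)%E].
Proof.
have [C C0 hC] := post_risk_null_le delta0 delta_q q2.
pose r := q - delta; have r0 : 0 < r by rewrite subr_gt0.
have r2 : r <= 2 by rewrite /r; have := delta0; have := q2; lra.
pose K : R := (normal_peak 2)^-1.
have K0 : 0 < K by rewrite invr_gt0 normal_peak_gt0.
(* [64 / r] is [2 / r] from the window integral, times 4 from [powR_normD_le], times 8 from
   [sqrt_powR_le]; [K] is the integral of [exp (- x^2 / 8)], a Gaussian of standard deviation 2. *)
exists (C * (64 / r + K)) => [|alpha a02].
  by rewrite mulr_gt0// addr_gt0 ?divr_gt0.
have [a0 a2] := andP a02.
have a01 : 0 < alpha < 1.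
  by rewrite a0/=; apply: le_lt_trans a2 _; rewrite invf_lt1// ltr1n.
have L0 := lnV_ge0 a01.
pose z := Num.sqrt (8 * L alpha); have z0 : 0 <= z by exact: sqrtr_ge0.
pose I := `[- z, z]%classic.
pose f x := C * alpha *
  ((\1_I x : R) * (1 + `|x|) `^ (r - 1) + expR (- (x ^+ 2 / 8))).
have mf1 : measurable_fun setT (fun x : R => (\1_I x : R) * (1 + `|x|) `^ (r - 1)).
  apply: measurable_funM; last exact: measurable_onePnorm_powR.
  by apply: measurable_indic; exact: measurable_itv.
have mf2 : measurable_fun setT (fun x : R => expR (- (x ^+ 2 / 8))).
  apply: measurableT_comp => //; apply: measurableT_comp => //.
  by apply: measurable_funM => //; exact: measurable_funX.
have f1_ge0 x : 0 <= (\1_I x : R) * (1 + `|x|) `^ (r - 1).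
  by rewrite mulr_ge0 ?powR_ge0.
have mf12 := measurable_funD mf1 mf2.
have mf : measurable_fun setT f by apply: measurable_funM.
have f0 x : 0 <= f x.
  by rewrite mulr_ge0 ?addr_ge0 ?expR_ge0// mulr_ge0// ltW.
exists (fun x => f x / phi x); split.
- exact: measurable_div_phi.
- by move=> x; rewrite divr_ge0// ltW ?phi_gt0.
- by move=> x; exact: hC.
rewrite null_integral_div_phi// /f.
under eq_integral do rewrite EFinM.
rewrite ge0_integralZl_EFin//; last 2 first.
- by apply/measurable_EFinP.
- by rewrite mulr_ge0// ltW.
have -> : C * (64 / r + K) * (alpha * (1 + L alpha `^ ((q - delta) / 2))) =
    C * alpha * ((64 / r + K) * (1 + L alpha `^ (r / 2))) by rewrite /r; ring.
rewrite [leRHS]EFinM lee_wpmul2l ?lee_fin//.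
  by rewrite mulr_ge0// ltW.
under eq_integral do rewrite EFinD.
rewrite ge0_integralD//; last 2 first.
- by apply/measurable_EFinP.
- by apply/measurable_EFinP.
set Lr := L alpha `^ (r / 2); have Lr0 : 0 <= Lr by exact: powR_ge0.
apply: (@le_trans _ _ ((2 * ((1 + z) `^ r / r))%:E + K%:E)%E); last first.
  rewrite -EFinD lee_fin.
  have zr : (1 + z) `^ r <= 4 * (1 + 8 * Lr).
    have := powR_normD_le r0 r2 1 z; rewrite !ger0_norm ?addr_ge0// powR1.
    move=> /le_trans; apply; rewrite ler_pM2l// lerD2l.
    by apply: sqrt_powR_le; rewrite ?(ltW r0).
  rewrite [leRHS]mulrDl lerD//; last by rewrite ler_pMr// lerDl.
  rewrite mulrA ler_pdivrMr//.
  have -> : 64 / r * (1 + Lr) * r = 64 * (1 + Lr).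
    by field; exact: lt0r_neq0.
  by nra.
apply: leeD.
  have := integral_onePnorm_powR_itv r0 z0; apply: le_trans.
  rewrite le_eqVlt; apply/orP; left; apply/eqP.
  rewrite [RHS]integral_mkcond; apply: eq_integral => x _.
  rewrite patchE indicE; case: (x \in _); first by rewrite mul1r.
  by rewrite mul0r.
rewrite /K -(integral_normal_fun 0)//.
rewrite le_eqVlt; apply/orP; left; apply/eqP.
apply: eq_integral => x _; rewrite /normal_fun subr0 mulNr.
congr (expR (- (_ / _)))%:E.
ring.
Qed.

(** The hypothesis says that the atom at 0 weighs more than 1/2. A half-line of mass at least 1/2
    must then contain 0, and both half-lines ending at the median have such a mass. *)
Lemma median_post_coord0 alpha x : 0 < alpha < 1 ->
  alpha * g x < (1 - alpha) * phi x ->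
  median (post_coord delta alpha x) = 0.
Proof.
move=> a01 ag; have [P PE intP] := post_coord_probability delta0 a01 x.
have D0 := marginal_gt0 delta0 a01 x.
have wlt : post_weight delta alpha x < 2^-1.
  by rewrite /post_weight ltr_pdivrMr//; lra.
have m1 : measurable [set (0 : R)] by exact: measurable_set1.
have P0 : ((1 - post_weight delta alpha x)%:E <= P [set 0%R])%E.
  have -> : P [set 0%R] = (\int[P]_u (\1_[set (0 : R)] u)%:E)%E.
    by rewrite integral_indic// setIT.
  rewrite intP; last 2 first.
  - exact: measurable_indic.
  - by move=> u; rewrite indicE.
  rewrite indicE mem_set// mulr1 leeDl// mule_ge0//.
    by rewrite lee_fin; exact: post_weight_ge0.
  apply: integral_ge0 => u _; rewrite lee_fin mulr_ge0//.
  exact: slab_post_ge0.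
have null (A : set (measurableTypeR R)) : measurable A ->
    ((2^-1)%:E <= P A)%E -> A 0.
  move=> mA hA; apply: contrapT => A0.
  have : (P A <= P (~` [set 0%R]))%E.
    apply: le_measure; rewrite ?inE//; first exact: measurableC.
    by move=> u Au /= u0; apply: A0; rewrite -u0.
  rewrite probability_setC//; move: P0 hA.
  rewrite -(fineK (fin_num_measure P _ m1)) -(fineK (fin_num_measure P _ mA)).
  by rewrite -EFinB !lee_fin => *; lra.
rewrite -PE; have [ml mr] := is_median_median P.
apply/eqP; rewrite eq_le; apply/andP; split.
  apply: (null _ _ mr); rewrite -set_itvcy; exact: measurable_itv.
apply: (null _ _ ml); rewrite -set_itvNyc; exact: measurable_itv.
Qed.

(** With the median at 0, the slab part alone is bounded below by [conv_ge] on [[x, x + 1]]: there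
    [u^q >= x^q] and, as [x >= 1], [1 + u <= 3 x]. The 2 in the constant comes from the marginal
    being at most [2 phi x]. *)
Lemma post_risk_ge : exists2 c : R, 0 < c & forall alpha x, 0 < alpha < 1 ->
  1 <= x -> alpha * g x < (1 - alpha) * phi x ->
  ((c * alpha * x `^ (q - delta - 1) / phi x)%:E <=
   post_risk delta q alpha x)%E.
Proof.
have cst0 := slab_cst_gt0 delta0; have p1 := phi_gt0 (1 : R).
pose b0 : R := slab_cst delta * 3 `^ (- 1 - delta).
have b00 : 0 < b0 by rewrite mulr_gt0 ?powR_gt0.
exists (b0 * phi 1 / 2) => [|alpha x a01 x1 ag].
  by rewrite divr_gt0 ?mulr_gt0.
have [P PE intP] := post_coord_probability delta0 a01 x.
have x0 : 0 < x by exact: lt_le_trans x1.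
rewrite /post_risk median_post_coord0// -PE intP; last 2 first.
- exact: (measurable_norm_sub_powR q 0).
- by move=> u; exact: powR_ge0.
rewrite subr0 normr0 powR0 ?(gt_eqF q0)// mulr0 add0e.
rewrite integral_slab_post//; last 1 first.
  exact: (measurable_norm_sub_powR q 0).
have D0 := marginal_gt0 delta0 a01 x; have gx := slab_conv_gt0 delta0 x.
have px := phi_gt0 x; have [a0 a1] := andP a01.
rewrite muleA -EFinM.
pose b := b0 * x `^ (q - delta - 1).
have b_ge0 : 0 <= b by rewrite mulr_ge0 ?powR_ge0 ?(ltW b00).
have w0 : 0 <= post_weight delta alpha x / g x.
  by rewrite divr_ge0 ?(ltW gx)//; exact: post_weight_ge0.
apply: (@le_trans _ _
  ((post_weight delta alpha x / g x)%:E * (b * phi 1)%:E)%E); last first.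
  apply: lee_wpmul2l; first by rewrite lee_fin.
  apply: conv_ge => //.
    by move=> u; rewrite mulr_ge0 ?powR_ge0 ?(ltW (slab_gt0 delta0 _)).
  move=> u /andP[xu ux]; have u0 : 0 < u by exact: lt_le_trans xu.
  rewrite subr0 (gtr0_norm u0) /b /b0 /slab /slab_kernel (gtr0_norm u0).
  have -> : x `^ (q - delta - 1) = x `^ q * x `^ (- 1 - delta).
    rewrite -powRD; last by apply/implyP => _; rewrite gt_eqF.
    by congr (_ `^ _); ring.
  rewrite [leRHS]mulrCA -[leLHS]mulrA ler_pM2l// [leLHS]mulrCA -powRM ?(ltW x0)//.
  apply: ler_pM; rewrite ?powR_ge0//.
    by rewrite ge0_ler_powR ?nnegrE ?(ltW q0) ?(ltW x0) ?(ltW u0).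
  have -> : - 1 - delta = - (1 + delta) by ring.
  rewrite !(powRN _ (1 + delta)) lef_pV2 ?posrE ?powR_gt0 ?mulr_gt0//; last first.
    by rewrite addr_gt0.
  rewrite ge0_ler_powR ?nnegrE ?addr_ge0 ?mulr_ge0 ?(ltW u0) ?(ltW x0) ?(ltW delta0)//.
  by lra.
rewrite -EFinM lee_fin /post_weight /b.
have pn0 := lt0r_neq0 px; have Dn0 := lt0r_neq0 D0; have gn0 := lt0r_neq0 gx.
set t := x `^ _; have t0 : 0 <= t by exact: powR_ge0.
set D := (1 - alpha) * phi x + alpha * g x in D0 Dn0 *.
have -> : alpha * g x / D / g x * (b0 * t * phi 1) =
    alpha * b0 * t * phi 1 * D^-1 by field; rewrite Dn0.
have -> : b0 * phi 1 / 2 * alpha * t / phi x =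
    alpha * b0 * t * phi 1 * (2 * phi x)^-1 by field.
apply: ler_wpM2l.
  exact: mulr_ge0 (mulr_ge0 (mulr_ge0 (ltW a0) (ltW b00)) t0) (ltW p1).
rewrite lef_pV2 ?posrE ?mulr_gt0// /D.
by nra.
Qed.

Lemma null_risk_ge : exists c alpha1 : R, [/\ 0 < c, 0 < alpha1 &
  forall alpha, 0 < alpha < 1 -> alpha <= alpha1 ->
  1 <= L alpha /\
  exists h : R -> R, [/\ measurable_fun setT h, forall x, 0 <= h x,
    forall x, ((h x)%:E <= post_risk delta q alpha x)%E &
    ((c * (alpha * L alpha `^ ((q - delta) / 2)))%:E <=
     \int[normal_prob (0 : R) 1]_x (h x)%:E)%E]].
Proof.
have [c c0 hc] := post_risk_ge; have [C C0 hC] := slab_conv_le delta0.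
pose k : R := normal_peak 1; have k0 : 0 < k by exact: normal_peak_gt0.
pose beta : R := k / (4 * C).
have beta0 : 0 < beta by rewrite divr_gt0 ?mulr_gt0.
pose r := q - delta; have r0 : 0 < r by rewrite subr_gt0.
have r2 : r <= 2 by rewrite /r; have := delta0; have := q2; lra.
(* [alpha <= exp (-4)] gives [sqrt L >= 2], so the window [[sqrt L / 2, sqrt L]] lies in [[1, +oo)].
   On it [phi x >= k sqrt alpha], whereas [alpha g x <= C alpha]; with [sqrt alpha <= beta] the
   latter is at most a quarter of [k sqrt alpha], and the spike wins. *)
exists (c / 4), (Num.min (expR (- 4)) (beta ^+ 2)); split.
- by rewrite divr_gt0.
- by rewrite lt_min expR_gt0 exprn_gt0.
move=> alpha a01; rewrite le_min => /andP[a4 ab]; have [a0 a1] := andP a01.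
have L4 : 4 <= L alpha.
  by rewrite lnV ?posrE// lerNr -(expRK (- 4)) ler_ln ?posrE ?expR_gt0.
split; first by lra.
have L0 : 0 <= L alpha by exact: lnV_ge0.
pose z := Num.sqrt (L alpha).
have z2 : 2 <= z.
  rewrite -[leLHS]ger0_norm// -sqrtr_sqr ler_wsqrtr//.
  by apply: le_trans L4; rewrite -natrX.
have z0 : 0 < z by exact: lt_le_trans z2.
pose I := `[z / 2, z]%classic.
have I1 x : I x -> 1 <= x by rewrite /I/= in_itv/= => /andP[? ?]; lra.
have Iag x : I x -> alpha * g x < (1 - alpha) * phi x.
  rewrite /I/= in_itv/= => /andP[zx xz].
  have x2 : x ^+ 2 <= L alpha.
    by rewrite -[leRHS]sqr_sqrtr// ler_pXn2r ?nnegrE ?sqrtr_ge0//; lra.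
  pose e := expR (- (L alpha / 2)).
  have e0 : 0 < e by exact: expR_gt0.
  have ae : alpha = e ^+ 2.
    rewrite expr2 /e -expRD -opprD -splitr lnV ?posrE// opprK lnK//.
  have eb : e <= beta.
    by rewrite -(ler_pXn2r (n := 2)) ?nnegrE ?(ltW e0) ?(ltW beta0)// -ae.
  have phix : k * e <= phi x.
    by rewrite phiE ler_pM2l// ler_expR lerN2 ler_pM2r.
  have a2 : alpha <= 2^-1.
    apply: le_trans a4 _; rewrite expRN lef_pV2 ?posrE ?expR_gt0//.
    by apply: le_trans (expR_ge1Dx _); lra.
  have h1 : alpha * g x <= e * (k / 4).
    rewrite ae expr2 -mulrA ler_pM2l//.
    apply: (@le_trans _ _ (beta * C)).
      by apply: ler_pM => //; [exact: ltW|exact/ltW/slab_conv_gt0].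
    rewrite /beta le_eqVlt; apply/orP; left; apply/eqP.
    by field; exact: lt0r_neq0.
  have ke : 0 < k * e by rewrite mulr_gt0.
  have : 2^-1 * (k * e) <= (1 - alpha) * phi x.
    by apply: ler_pM => //; [exact: ltW|lra].
  by lra.
(* On [[z / 2, z]] one has [x^(r - 1) >= z^(r - 1) / 2] whatever the sign of [r - 1], because
   [r <= 2]. The length [z / 2] of the window provides the other half of [c / 4]. *)
pose f x : R := c * alpha * (z `^ (r - 1) / 2) * \1_I x.
have zr0 : 0 <= z `^ (r - 1) by exact: powR_ge0.
have cst0 : 0 <= c * alpha * (z `^ (r - 1) / 2).
  by rewrite mulr_ge0 ?divr_ge0// mulr_ge0// ltW.
have mI : measurable I by exact: measurable_itv.
have mf : measurable_fun setT f.
  by apply: measurable_funM => //; exact: measurable_indic.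
have f0 x : 0 <= f x by rewrite mulr_ge0.
exists (fun x => f x / phi x); split.
- exact: measurable_div_phi.
- by move=> x; rewrite divr_ge0// ltW ?phi_gt0.
- move=> x; rewrite /f indicE; have [xI|_] := boolP (x \in I); last first.
    by rewrite mulr0 mul0r; exact: post_risk_ge0.
  move/set_mem : xI => xI.
  apply: le_trans (hc _ _ a01 (I1 _ xI) (Iag _ xI)).
  rewrite mulr1 lee_fin ler_pM2r ?invr_gt0 ?phi_gt0// ler_wpM2l//.
    by rewrite mulr_ge0// ltW.
  move: xI; rewrite /I/= in_itv/= => /andP[zx xz].
  have x0 : 0 < x by lra.
  rewrite -/r; have [r1|r1] := leP 1 r.
    apply: (@le_trans _ _ ((z / 2) `^ (r - 1))); last first.
      by rewrite ge0_ler_powR ?nnegrE ?divr_ge0 ?subr_ge0 ?(ltW z0) ?(ltW x0).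
    rewrite powRM ?(ltW z0)// ler_wpM2l// -[leLHS]powRr1// ger_powR//; last lra.
    by rewrite invr_gt0 ltr0n invf_le1// ler1n.
  apply: (@le_trans _ _ (z `^ (r - 1))); first by lra.
  rewrite -(opprB 1 r) !powRN lef_pV2 ?posrE ?powR_gt0//.
  by rewrite ge0_ler_powR ?nnegrE ?(ltW z0) ?(ltW x0)//; lra.
rewrite null_integral_div_phi// /f.
under eq_integral do rewrite EFinM.
rewrite ge0_integralZl_EFin//; last by apply/measurable_EFinP; exact: measurable_indic.
rewrite integral_indic//= setIT lebesgue_measure_itv/= lte_fin.
have -> : z / 2 < z by lra.
rewrite -EFinD -EFinM lee_fin le_eqVlt; apply/orP; left; apply/eqP.
have -> : L alpha `^ ((q - delta) / 2) = z * z `^ (r - 1).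
  by rewrite mulr_powRB1 ?(ltW z0)// /z -powR12_sqrt// -powRrM (mulrC 2^-1).
by field.
Qed.

End null_risk.

(** * Expected diameters *)

Section expected_diameter.
Context (R : realType) (delta q M : R).
Hypotheses (delta0 : 0 < delta) (delta_q : delta < q) (q2 : q <= 2) (M0 : 0 < M).
Local Open Scope ereal_scope.

Let q0 : (0 < q)%R. Proof. exact: lt_trans delta_q. Qed.

Lemma sum_neq0_card n (theta : n.-tuple R) :
  (\sum_(i < n) (tnth theta i != 0)%:R =
   #|[pred i : 'I_n | tnth theta i != 0]|%:R :> R)%R.
Proof.
rewrite -sum1_card natr_sum [RHS]big_mkcond/=.
by apply: eq_bigr => i _; rewrite inE; case: ifP.
Qed.

Lemma Xlaw_integral_sum n (theta : n.-tuple R) :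
  exists2 P : probability (n.-tuple (measurableTypeR R)) R,
    (P : set (n.-tuple (measurableTypeR R)) -> \bar R) = Xlaw theta
  & forall f : 'I_n -> measurableTypeR R -> \bar R,
    (forall i, measurable_fun setT (f i)) -> (forall i x, 0 <= f i x) ->
    \int[P]_X (\sum_(i < n) f i (tnth X i)) =
    \sum_(i < n) \int[normal_prob (tnth theta i) 1]_x f i x.
Proof.
have [P PE intP] := prod_law_integral_sum (fun i : 'I_n =>
  (normal_prob (tnth theta i) 1 : probability (measurableTypeR R) R)).
by exists P.
Qed.

Lemma vq_ge0 alpha n (X : n.-tuple R) : (0 < alpha < 1)%R ->
  0 <= vq delta q alpha X.
Proof.
by move=> a01; rewrite vqE//; apply: sume_ge0 => i _; exact: post_risk_ge0.
Qed.

Lemma diamq_cred_ge0 alpha n (X : n.-tuple R) : (0 < alpha < 1)%R ->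
  0 <= diamq q (cred delta q M alpha X).
Proof.
move=> a01; set m := post_median delta alpha X.
have mm : dq q m m = 0%R.
  by rewrite /dq big1// => i _; rewrite subrr normr0 powR0// gt_eqF.
apply: ereal_sup_ubound; exists (m, m); last by rewrite /= mm.
by split; rewrite /cred/= mm mule_ge0 ?lee_fin ?(ltW M0)// vq_ge0.
Qed.

Lemma Ediam_ge0 (alpha : R) n (theta : n.-tuple R) : (0 < alpha < 1)%R ->
  0 <= Ediam delta q M alpha theta.
Proof.
move=> a01; have [P PE _] := Xlaw_integral_sum theta.
rewrite /Ediam /expect -PE; apply: integral_ge0 => X _.
exact: diamq_cred_ge0.
Qed.

(** A nonzero coordinate has an arbitrary mean, so it receives the uniform bound [B]; a null one
    receives [h]. The bound [A] is charged to all [n] coordinates. *)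
Lemma Ediam_le alpha n (s B A : R) (h : R -> R) (theta : n.-tuple R) :
  (0 < alpha < 1)%R -> (0 <= B)%R -> (0 <= A)%R ->
  measurable_fun setT h -> (forall x, 0 <= h x)%R ->
  (forall x, post_risk delta q alpha x <= B%:E) ->
  (forall x, post_risk delta q alpha x <= (h x)%:E) ->
  \int[normal_prob (0 : R) 1]_x (h x)%:E <= A%:E ->
  sparse s theta ->
  Ediam delta q M alpha theta <= (8 * M * (s * B + n%:R * A))%:E.
Proof.
move=> a01 B0 A0 mh h0 riskB riskh hA theta_s.
have [P PE intP] := Xlaw_integral_sum theta.
pose f (i : 'I_n) (x : measurableTypeR R) : \bar R :=
  (8 * M)%:E * (if tnth theta i == 0%R then h x else B)%:E.
have M8 : (0 <= 8 * M)%R by rewrite mulr_ge0// ltW.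
have f0 i x : 0 <= f i x.
  by rewrite /f mule_ge0// lee_fin//; case: ifP.
have mf i : measurable_fun setT (f i).
  apply/emeasurable_funM => //; apply/measurable_EFinP.
  by case: (tnth theta i == 0%R).
rewrite /Ediam /expect -PE.
apply: (@le_trans _ _ (\int[P]_X (\sum_(i < n) f i (tnth X i)))).
  apply: ge0_le_integralT => X; first exact: diamq_cred_ge0.
  apply: le_trans (diamq_ball_le q0 q2 (post_median delta alpha X) _) _.
  rewrite muleA -EFinM vqE// ge0_sume_distrr; last by move=> i _; exact: post_risk_ge0.
  apply: lee_sum => i _; apply: lee_wpmul2l; first by rewrite lee_fin.
  by case: ifP.
rewrite intP//.
apply: (@le_trans _ _
  (\sum_(i < n) (8 * M * ((tnth theta i != 0%R)%:R * B + A))%:E)).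
  apply: lee_sum => i _; rewrite /f.
  have [ti|ti] := eqVneq (tnth theta i) 0%R.
    rewrite ti ge0_integralZl_EFin//; last 2 first.
    - by move=> x _; rewrite lee_fin.
    - by apply/measurable_EFinP.
    by rewrite mul0r add0r [leRHS]EFinM lee_wpmul2l ?lee_fin.
  rewrite integral_cst// [X in _ * X]probability_setT mule1 lee_fin.
  by rewrite mul1r ler_wpM2l// lerDl.
rewrite sumEFin lee_fin -mulr_sumr ler_wpM2l// big_split/= sumr_const card_ord.
rewrite -[(A *+ n)%R]mulr_natl lerD2r -mulr_suml ler_wpM2r//.
by rewrite sum_neq0_card.
Qed.

(** Nonzero coordinates are bounded below by 0; at least [n - s] null ones remain, wherever they
    are, which makes the bound uniform over sparse vectors. *)
Lemma Ediam_ge alpha n (s A : R) (h : R -> R) (theta : n.-tuple R) :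
  (0 < n)%N -> (0 < alpha < 1)%R -> (0 <= A)%R ->
  measurable_fun setT h -> (forall x, 0 <= h x)%R ->
  (forall x, (h x)%:E <= post_risk delta q alpha x) ->
  A%:E <= \int[normal_prob (0 : R) 1]_x (h x)%:E ->
  sparse s theta ->
  (M * ((n%:R - s) * A))%:E <= Ediam delta q M alpha theta.
Proof.
case: n theta => // n theta _ a01 A0 mh h0 riskh hA theta_s.
have [P PE intP] := Xlaw_integral_sum theta.
pose f (i : 'I_n.+1) (x : measurableTypeR R) : \bar R :=
  M%:E * (if tnth theta i == 0%R then h x else 0%R)%:E.
have f0 i x : 0 <= f i x.
  by rewrite /f mule_ge0// lee_fin ?(ltW M0)//; case: ifP.
have mf i : measurable_fun setT (f i).
  apply/emeasurable_funM => //; apply/measurable_EFinP.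
  by case: (tnth theta i == 0%R).
rewrite /Ediam /expect -PE.
apply: (@le_trans _ _ (\int[P]_X (\sum_(i < n.+1) f i (tnth X i)))); last first.
  apply: ge0_le_integralT => X; first exact: sume_ge0.
  have MV : 0 <= M%:E * vq delta q alpha X.
    by rewrite mule_ge0 ?lee_fin ?(ltW M0)// vq_ge0.
  apply: le_trans (diamq_ball_ge q0 (post_median delta alpha X) MV).
  rewrite vqE// ge0_sume_distrr; last by move=> i _; exact: post_risk_ge0.
  apply: lee_sum => i _; apply: lee_wpmul2l; first by rewrite lee_fin ltW.
  by case: ifP => // _; exact: post_risk_ge0.
rewrite intP//.
apply: (@le_trans _ _
  (\sum_(i < n.+1) (M * ((1 - (tnth theta i != 0%R)%:R) * A))%:E)).
  rewrite sumEFin lee_fin -mulr_sumr ler_pM2l// -mulr_suml ler_wpM2r//.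
  rewrite big_split/= sumr_const card_ord sumrN lerD2l lerN2.
  by rewrite sum_neq0_card.
apply: lee_sum => i _; rewrite /f.
have [ti|ti] := eqVneq (tnth theta i) 0%R.
  rewrite ti ge0_integralZl_EFin//; last 3 first.
  - by move=> x _; rewrite lee_fin.
  - by apply/measurable_EFinP.
  - exact: ltW.
  by rewrite subr0 mul1r [leLHS]EFinM lee_wpmul2l ?lee_fin// ltW.
by rewrite subrr mul0r mulr0; apply: integral_ge0 => x _; rewrite mule0.
Qed.

End expected_diameter.

(** * Comparison of the rates *)

Section asymptotics.
Context (R : realType).
Implicit Types (s alpha : nat -> R) (l y : R).

Lemma sparsity_regime_near kappa1 s (Y : R) : sparsity_regime kappa1 s -> 0 < Y ->
  \forall n \near \oo, 1 <= s n /\ Y <= n%:R / s n.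
Proof.
move=> [s_oo /eqoP s_o _] Y0; near=> n.
have s1 : 1 <= s n by near: n; move/cvgryPge : s_oo; exact.
split => //; have s0 : 0 < s n by exact: lt_le_trans s1.
rewrite ler_pdivlMr// mulrC -ler_pdivlMr// mulrC.
have : `|s n| <= Y^-1 * `|n%:R : R|.
  by near: n; apply: s_o; rewrite invr_gt0.
by rewrite !ger0_norm ?(ltW s0).
Unshelve. all: by end_near. Qed.

Lemma ln_le_sqrt y : 0 < y -> ln y <= 2 * Num.sqrt y.
Proof.
move=> y0; have w0 : 0 < Num.sqrt y by rewrite sqrtr_gt0.
rewrite -{1}(sqr_sqrtr (ltW y0)) lnXn// -[ln _ *+ _]mulr_natl ler_pM2l//.
exact/ltW/ln_sublinear.
Qed.

Lemma powR_ge1 l p : 1 <= l -> 0 <= p -> 1 <= l `^ p.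
Proof. by move=> l1 p0; rewrite -(powRr0 l) ler_powR. Qed.

Lemma upper_rate (K l L p : R) : 1 <= K -> 1 <= l -> 0 <= L -> L <= K * l ->
  0 <= p <= 1 -> 1 + L `^ p <= (1 + K) * l `^ p.
Proof.
move=> K1 l1 L0 LK /andP[p0 p1].
have lp := powR_ge1 l1 p0.
have : L `^ p <= K * l `^ p.
  apply: (@le_trans _ _ ((K * l) `^ p)).
    by rewrite ge0_ler_powR ?nnegrE// mulr_ge0; lra.
  rewrite powRM; [|lra|lra]; rewrite ler_wpM2r ?powR_ge0//.
  by apply: le_trans (ler_powR K1 p1) _; rewrite powRr1//; lra.
by lra.
Qed.

End asymptotics.

Section proposition.
Context (R : realType) (delta q kappa1 M : R).
Hypotheses (delta0 : 0 < delta) (delta2 : delta < 2) (delta_q : delta < q)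
  (q2 : q <= 2) (M0 : 0 < M).
Implicit Types (s alpha : nat -> R).

Let q0 : 0 < q. Proof. exact: lt_trans delta_q. Qed.

Lemma proposition2_lower : exists2 alpha1 : R, 0 < alpha1 &
  forall s alpha, sparsity_regime kappa1 s ->
    (forall n, 0 < alpha n < 1) ->
    (fun n => s n * ln (n%:R / s n) `^ (delta / 2) / n%:R : R^o)
      =o_\oo (alpha : nat -> R^o) ->
    (\forall n \near \oo, alpha n <= alpha1) ->
    elittleo (fun n => (rate s q n)%:E)
      (fun n => ereal_inf [set Ediam delta q M (alpha n) theta0
                          | theta0 in @sparse R n (s n)]).
Proof.
have [c [alpha1 [c0 alpha1_gt0 hc]]] := null_risk_ge delta0 delta_q q2.
exists alpha1 => // s alpha hs a01 /eqoP sa aalpha1 e e0.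
(* The half accounts for [n - s >= n / 2]. *)
pose e' := e * (M * c / 2).
have e'0 : 0 < e' by rewrite !mulr_gt0// ?mulr_gt0// invr_gt0.
(* Thresholds for [y = n / s]: 2 gives [s <= n / 2], [exp 1] gives [l >= 1], and the last one gives
   [y^(1/4) >= 4 / e']. *)
pose Y := Num.max (Num.max 2 (expR 1)) ((4 / e') ^+ 4).
have Y0 : 0 < Y by rewrite !lt_max ltr0n.
near=> n.
have [s1 hY] : 1 <= s n /\ Y <= n%:R / s n.
  by near: n; exact: sparsity_regime_near hs Y0.
have an1 : alpha n <= alpha1 by near: n.
have hsa : `|s n * ln (n%:R / s n) `^ (delta / 2) / n%:R| <= e' / 2 * `|alpha n|.
  by near: n; apply: sa; rewrite divr_gt0.
have [a0 a1] := andP (a01 n).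
have [L1 [h [mh h0 hrisk hint]]] := hc _ (a01 n) an1.
set l := ln (n%:R / s n) in hsa *; set L := ln (alpha n)^-1 in L1 hint *.
set y := n%:R / s n in hY l hsa *.
have s0 : 0 < s n by exact: lt_le_trans s1.
move: hY; rewrite /Y !ge_max => /andP[/andP[y2 ye] y4].
have y0 : 0 < y by exact: lt_le_trans y2.
have nE : n%:R = s n * y by rewrite /y mulrC divfK// gt_eqF.
have n0 : 0 < n%:R :> R by rewrite nE mulr_gt0.
have l1 : 1 <= l by rewrite -[leLHS](expRK 1) ler_ln ?posrE ?expR_gt0.
have l0 : 0 < l by exact: lt_le_trans l1.
have L0 : 0 < L by exact: lt_le_trans L1.
pose r := q - delta; have r0 : 0 < r by rewrite subr_gt0.
have r2 : r <= 2 by rewrite /r; have := delta0; have := q2; lra.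
have lqE : l `^ (q / 2) = l `^ (delta / 2) * l `^ (r / 2).
  rewrite -powRD; last by apply/implyP => _; rewrite gt_eqF.
  by congr (_ `^ _); rewrite /r; field.
have Lr0 : 0 <= L `^ (r / 2) by exact: powR_ge0.
(* If alpha <= sqrt (s / n), then L >= l / 2 and the littleo hypothesis is enough;
   otherwise n alpha >= s sqrt (n / s) already dominates s l^(q/2). *)
have main : s n * l `^ (q / 2) <= e' * (n%:R * (alpha n * L `^ (r / 2))).
  have [ay|ya] := leP (alpha n ^+ 2) y^-1.
    have lL : l <= 2 * L.
      rewrite /l /L lnV ?posrE//.
      have : ln (alpha n ^+ 2) <= ln y^-1.
        by rewrite ler_ln ?posrE ?exprn_gt0 ?invr_gt0.
      by rewrite lnXn// lnV ?posrE// -[ln _ *+ _]mulr_natl; lra.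
    have lLr : l `^ (r / 2) <= 2 * L `^ (r / 2).
      apply: (@le_trans _ _ ((2 * L) `^ (r / 2))).
        by rewrite ge0_ler_powR ?nnegrE ?mulr_ge0 ?divr_ge0 ?(ltW l0) ?(ltW L0) ?(ltW r0).
      rewrite powRM ?(ltW L0)// ler_wpM2r//.
      by rewrite -[leRHS]powRr1// ler_powR ?ler1n//; lra.
    move: hsa; rewrite ger0_norm; last first.
      by rewrite divr_ge0 ?mulr_ge0 ?powR_ge0// ltW.
    rewrite (gtr0_norm a0) ler_pdivrMr// => hsa.
    rewrite lqE mulrA.
    apply: (@le_trans _ _ (e' / 2 * alpha n * n%:R * (2 * L `^ (r / 2)))).
      by apply: ler_pM => //; rewrite ?powR_ge0// mulr_ge0 ?powR_ge0// ltW.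
    by rewrite le_eqVlt; apply/orP; left; apply/eqP; field.
  (* With [w = y^(1/4)], [l = 4 ln w <= 4 w <= e' w^2], and [alpha w^2 >= 1] in this case. As
     [n = s w^4], one factor [w^2] beats the logarithm and the other compensates [alpha]. *)
  pose w := Num.sqrt (Num.sqrt y).
  have sy0 : 0 < Num.sqrt y by rewrite sqrtr_gt0.
  have w0 : 0 < w by rewrite sqrtr_gt0.
  have w2 : w ^+ 2 = Num.sqrt y by rewrite sqr_sqrtr// ltW.
  have w4 : w ^+ 4 = y by rewrite -[4%N]/(2 * 2)%N exprM w2 sqr_sqrtr// ltW.
  have ew : 4 <= e' * w.
    rewrite mulrC -ler_pdivrMr// -(ler_pXn2r (n := 4)) ?nnegrE ?(ltW w0)//.
      by rewrite w4.
    by rewrite divr_ge0// ltW.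
  have lq : l `^ (q / 2) <= e' * w ^+ 2.
    apply: (@le_trans _ _ (4 * w)).
      apply: (@le_trans _ _ l).
        rewrite -[leRHS]powRr1 ?(ltW l0)// ler_powR//.
        by have := q2; lra.
      rewrite /l -w4 lnXn// -[ln _ *+ _]mulr_natl ler_pM2l//.
      exact/ltW/ln_sublinear.
    by rewrite expr2 mulrA ler_wpM2r// ltW.
  have aw : 1 <= alpha n * w ^+ 2.
    rewrite -(ler_pXn2r (n := 2)) ?nnegrE ?mulr_ge0 ?exprn_ge0 ?(ltW w0) ?(ltW a0)//.
    rewrite expr1n exprMn -exprM w4 -ler_pdivrMr// div1r.
    exact: ltW.
  have L1r : 1 <= L `^ (r / 2).
    by apply: powR_ge1 => //; rewrite divr_ge0// ltW.
  have yE : y = w ^+ 2 * w ^+ 2 by rewrite -exprD.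
  rewrite nE yE; set W := w ^+ 2 in lq aw *.
  have -> : e' * (s n * (W * W) * (alpha n * L `^ (r / 2))) =
    s n * ((e' * W) * ((alpha n * W) * L `^ (r / 2))) by ring.
  rewrite ler_pM2l//; apply: le_trans lq _.
  have eW : 0 <= e' * W by apply: mulr_ge0; apply: ltW => //; exact: exprn_gt0.
  apply: ler_peMr => //.
  by rewrite -[leLHS]mulr1 ler_pM.
have ns : s n <= n%:R / 2 by rewrite nE; nra.
have n1 : (0 < n)%N by rewrite -(ltr0n R).
rewrite gee0_abs ?lee_fin ?mulr_ge0 ?powR_ge0 ?(ltW s0)//.
have bound : ((M * (n%:R / 2 * (c * (alpha n * L `^ (r / 2)))))%:E <=
    ereal_inf [set Ediam delta q M (alpha n) theta0
              | theta0 in @sparse R n (s n)])%E.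
  apply: le_ereal_inf_tmp => _ [theta theta_s <-].
  apply: le_trans
    (Ediam_ge delta0 delta_q M0 n1 (a01 n) _ mh h0 hrisk hint theta_s).
    rewrite lee_fin ler_pM2l// ler_wpM2r ?mulr_ge0 ?(ltW c0) ?(ltW a0)//.
    by lra.
  by rewrite mulr_ge0 ?(ltW c0)// mulr_ge0// ltW.
have B0 : 0 <= M * (n%:R / 2 * (c * (alpha n * L `^ (r / 2)))).
  rewrite mulr_ge0 ?(ltW M0)// mulr_ge0 ?divr_ge0 ?(ltW n0)//.
  by rewrite mulr_ge0 ?(ltW c0)// mulr_ge0// ltW.
rewrite gee0_abs; last by apply: le_trans bound; rewrite lee_fin.
apply: (@le_trans _ _ (e%:E * (M * (n%:R / 2 * (c * (alpha n * L `^ (r / 2)))))%:E)%E).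
  rewrite -EFinM lee_fin; apply: le_trans main _.
  by rewrite le_eqVlt; apply/orP; left; apply/eqP; rewrite /e'; field.
by rewrite lee_wpmul2l// lee_fin ltW.
Unshelve. all: by end_near. Qed.

Lemma proposition2_upper s alpha (c1 : R) :
  sparsity_regime kappa1 s -> (forall n, 0 < alpha n < 1) -> 1 <= c1 ->
  (fun n => (s n / n%:R) `^ c1 : R^o) =O_\oo (alpha : nat -> R^o) ->
  (alpha : nat -> R^o) =O_\oo
    (fun n => s n / n%:R * ln (n%:R / s n) `^ (delta / 2) : R^o) ->
  ebigO
    (fun n => ereal_sup [set Ediam delta q M (alpha n) theta0
                        | theta0 in @sparse R n (s n)])
    (fun n => (rate s q n)%:E).
Proof.
move=> hs a01 c11 /eqO_exP[k1 k1_gt0 sa] /eqO_exP[k2 k2_gt0 as_].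
have [C1 C1_gt0 hC1] := post_risk_unif_le delta0 delta_q q2.
have [C2 C2_gt0 hC2] := null_risk_le delta0 delta_q q2.
(* From [y^(-c1) <= k1 alpha] follows [L <= c1 l + ln k1], which is at most [K l] because
   [l >= 1]. *)
pose K := `|ln k1| + c1.
have K1 : 1 <= K by rewrite /K; have := normr_ge0 (ln k1); lra.
pose C := 8 * M * ((1 + K) * (C1 + C2 * k2)).
have C0 : 0 < C.
  have K10 : 0 < 1 + K by lra.
  apply: mulr_gt0; first by rewrite mulr_gt0.
  by apply: mulr_gt0 => //; rewrite addr_gt0// mulr_gt0.
exists C => //.
(* [exp 1] gives [l >= 1]. The second threshold gives [alpha <= 1/2], since [alpha <= k2 l^(delta/2)
   / y <= 2 k2 / sqrt y]. *)
pose Y := Num.max (expR 1) ((4 * k2) ^+ 2).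
have Y0 : 0 < Y by rewrite lt_max expR_gt0.
near=> n.
have [s1 hY] : 1 <= s n /\ Y <= n%:R / s n.
  by near: n; exact: sparsity_regime_near hs Y0.
have sa' : `|(s n / n%:R) `^ c1| <= k1 * `|alpha n| by near: n.
have as' : `|alpha n| <= k2 * `|s n / n%:R * ln (n%:R / s n) `^ (delta / 2)|.
  by near: n.
have [a0 a1] := andP (a01 n).
have s0 : 0 < s n by exact: lt_le_trans s1.
set y := n%:R / s n in hY as'; set l := ln y in as'.
move: hY; rewrite /Y ge_max => /andP[ye y4].
have y0 : 0 < y by apply: lt_le_trans ye; exact: expR_gt0.
have nE : n%:R = s n * y by rewrite /y mulrC divfK// gt_eqF.
have snE : s n / n%:R = y^-1 by rewrite /y invf_div.
have n0 : 0 < n%:R :> R by rewrite nE mulr_gt0.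
have l1 : 1 <= l by rewrite -[leLHS](expRK 1) ler_ln ?posrE ?expR_gt0.
have l0 : 0 < l by exact: lt_le_trans l1.
set L := ln (alpha n)^-1; have L0 : 0 <= L by exact: lnV_ge0.
pose r := q - delta; have r0 : 0 < r by rewrite subr_gt0.
have r2 : r <= 2 by rewrite /r; have := delta0; have := q2; lra.
have ld0 : 0 <= l `^ (delta / 2) by exact: powR_ge0.
rewrite snE (gtr0_norm a0) ger0_norm ?powR_ge0// in sa'.
rewrite snE (gtr0_norm a0) ger0_norm in as'; last first.
  by rewrite mulr_ge0// invr_ge0 ltW.
have LK : L <= K * l.
  have : ln (y^-1 `^ c1) <= ln (k1 * alpha n).
    by rewrite ler_ln ?posrE ?powR_gt0 ?mulr_gt0 ?invr_gt0.
  rewrite ln_powR (lnV (x := y)) ?posrE// (lnM (x := k1)) ?posrE// -/l => h.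
  have LE : L = - ln (alpha n) by rewrite /L lnV.
  have k1l : ln k1 <= `|ln k1| * l.
    by apply: le_trans (ler_norm _) _; rewrite ler_peMr.
  by rewrite LE /K mulrDl; lra.
have a2 : 0 < alpha n <= 2^-1.
  rewrite a0; apply: le_trans as' _.
  have ly : l `^ (delta / 2) <= 2 * Num.sqrt y.
    apply: le_trans (ln_le_sqrt y0); rewrite -/l -[leRHS]powRr1 ?(ltW l0)//.
    by rewrite ler_powR//; have := delta2; lra.
  have sy0 : 0 < Num.sqrt y by rewrite sqrtr_gt0.
  have yE : y = Num.sqrt y * Num.sqrt y by rewrite -expr2 sqr_sqrtr// ltW.
  have k2y : 4 * k2 <= Num.sqrt y.
    rewrite -[leLHS]ger0_norm ?mulr_ge0 ?(ltW k2_gt0)// -sqrtr_sqr.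
    by rewrite ler_wsqrtr.
  have -> : k2 * (y^-1 * l `^ (delta / 2)) = k2 * l `^ (delta / 2) / y.
    by field; exact: lt0r_neq0.
  rewrite ler_pdivrMr// yE.
  apply: (@le_trans _ _ (k2 * (2 * Num.sqrt y))); first by rewrite ler_pM2l.
  have -> : k2 * (2 * Num.sqrt y) = 2^-1 * (4 * k2 * Num.sqrt y) by field.
  by rewrite ler_pM2l ?invr_gt0// ler_pM2r.
have [h [mh h0 hrisk hint]] := hC2 _ a2.
have lq0 : 0 <= l `^ (q / 2) by exact: powR_ge0.
have lqE : l `^ (q / 2) = l `^ (delta / 2) * l `^ (r / 2).
  rewrite -powRD; last by apply/implyP => _; rewrite gt_eqF.
  by congr (_ `^ _); rewrite /r; field.
have Lq : 1 + L `^ (q / 2) <= (1 + K) * l `^ (q / 2).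
  by apply: upper_rate => //; have := q0; have := q2; lra.
have Lr : 1 + L `^ (r / 2) <= (1 + K) * l `^ (r / 2).
  by apply: upper_rate => //; lra.
have na : n%:R * alpha n <= k2 * s n * l `^ (delta / 2).
  have -> : k2 * s n * l `^ (delta / 2) =
      n%:R * (k2 * (y^-1 * l `^ (delta / 2))).
    by rewrite nE; field; exact: lt0r_neq0.
  by rewrite ler_pM2l.
have A0 : 0 <= C2 * (alpha n * (1 + L `^ (r / 2))).
  apply: mulr_ge0; first exact: ltW.
  by apply: mulr_ge0; [exact: ltW|apply: addr_ge0 => //; exact: powR_ge0].
have B0 : 0 <= C1 * (1 + L `^ (q / 2)).
  by apply: mulr_ge0; [exact: ltW|apply: addr_ge0 => //; exact: powR_ge0].
(* In the null term, [n alpha] is worth [s l^(delta/2)] and the risk per unit of [alpha] is worth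
   [l^((q - delta)/2)]: the two powers multiply to the one found in the signal term. *)
have le_rate : 8 * M * (s n * (C1 * (1 + L `^ (q / 2))) +
    n%:R * (C2 * (alpha n * (1 + L `^ (r / 2))))) <= C * (s n * l `^ (q / 2)).
  have -> : C * (s n * l `^ (q / 2)) =
    8 * M * (s n * (C1 * ((1 + K) * l `^ (q / 2))) +
      C2 * (k2 * s n * l `^ (delta / 2) * ((1 + K) * l `^ (r / 2)))).
    by rewrite /C lqE; ring.
  rewrite ler_pM2l ?mulr_gt0//; apply: lerD.
    by rewrite !ler_pM2l.
  have -> : n%:R * (C2 * (alpha n * (1 + L `^ (r / 2)))) =
    C2 * (n%:R * alpha n * (1 + L `^ (r / 2))) by ring.
  rewrite ler_pM2l//; apply: ler_pM => //.
    by apply: mulr_ge0; exact: ltW.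
  by apply: addr_ge0 => //; exact: powR_ge0.
have sup_le : (ereal_sup [set Ediam delta q M (alpha n) theta0
    | theta0 in @sparse R n (s n)] <= (C * (s n * l `^ (q / 2)))%:E)%E.
  apply: ge_ereal_sup => _ [theta theta_s <-].
  apply: le_trans (Ediam_le delta0 delta_q q2 M0 (a01 n) B0 A0 mh h0
    (fun x => hC1 _ x (a01 n)) hrisk hint theta_s) _.
  by rewrite lee_fin.
have sup_ge : (0 <= ereal_sup [set Ediam delta q M (alpha n) theta0
    | theta0 in @sparse R n (s n)])%E.
  (* The zero vector shows that the supremum is over a nonempty set, hence nonnegative and equal to
     its absolute value. *)
  pose theta : n.-tuple R := [tuple 0 | i < n].
  apply: le_trans (Ediam_ge0 delta0 delta_q M0 theta (a01 n)) _.
  apply: ereal_sup_ubound; exists theta => //.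
  rewrite /sparse/= eq_card0 ?(ltW s0)// => i.
  by rewrite inE tnth_mktuple eqxx.
rewrite gee0_abs// gee0_abs; last first.
  by rewrite lee_fin mulr_ge0 ?(ltW s0)// powR_ge0.
by rewrite -EFinM.
Unshelve. all: by end_near. Qed.

End proposition.

Theorem proposition2 (R : realType) (delta q kappa1 M : R)
    (hdelta0 : 0 < delta) (hdelta2 : delta < 2)
    (hdq : delta < q) (hq2 : q <= 2)
    (hkappa1 : 0 < kappa1) (hM : 0 < M) :
  (exists2 alpha1 : R, 0 < alpha1 &
    forall s alpha : nat -> R,
      sparsity_regime kappa1 s ->
      (forall n, 0 < alpha n < 1) ->
      (fun n => s n * ln (n%:R / s n) `^ (delta / 2) / n%:R : R^o)
        =o_\oo (alpha : nat -> R^o) ->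
      (\forall n \near \oo, alpha n <= alpha1) ->
      elittleo (fun n => (rate s q n)%:E)
        (fun n => ereal_inf [set Ediam delta q M (alpha n) theta0
                            | theta0 in @sparse R n (s n)]))
  /\
  (forall (s alpha : nat -> R) (c1 : R),
      sparsity_regime kappa1 s ->
      (forall n, 0 < alpha n < 1) ->
      1 <= c1 ->
      (fun n => (s n / n%:R) `^ c1 : R^o) =O_\oo (alpha : nat -> R^o) ->
      (alpha : nat -> R^o) =O_\oo
        (fun n => s n / n%:R * ln (n%:R / s n) `^ (delta / 2) : R^o) ->
      ebigO
        (fun n => ereal_sup [set Ediam delta q M (alpha n) theta0
                            | theta0 in @sparse R n (s n)])
        (fun n => (rate s q n)%:E)).
Proof.
split; first exact: proposition2_lower.
move=> s alpha c1 hs a01 c11 sa as_.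
exact: (proposition2_upper hdelta0 hdelta2 hdq hq2 hM hs a01 c11 sa as_).
Qed.
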